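(* Every minimal surface of general type in $\mathbb R^4$ satisfying $\gamma_1=0$ locally admits canonical parameters, i.e. semi-canonical parameters $(u,v)$ with $$E=1,\qquad F=0,\qquad G=\frac{1}{\sqrt{|\mu^2-\nu^2|}} .$$
   Context: $\mathbb R^4$ carries the standard metric $g=\langle\cdot,\cdot\rangle$ and flat connection $\nabla'$; everything is smooth and local. For a regular surface $M^2: z=z(u,v)$ let $E,F,G$ be the first fundamental form coefficients, $\sigma$ the second fundamental form, $K$ the Gauss curvature, and $\varkappa$ the curvature of the normal connection, $\varkappa=g(R^\perp(x,y)n_2,n_1)$ for a positively oriented orthonormal frame $(x,y,n_1,n_2)$ with $x,y$ tangent. Minimal means $\sigma(x,x)+\sigma(y,y)=0$ for orthonormal tangent $x,y$. A minimal surface is of general type if $K^2-\varkappa^2>0$ and $\varkappa\neq0$ everywhere. The ellipse of curvature at $p$ is $\{\sigma(v,v): v\in T_pM^2,\ |v|=1\}$; a tangent line is canonical if it is collinear with an axis of this ellipse. The geometric frame is a positively oriented orthonormal frame $\{x,y,n_1,n_2\}$ with $x,y$ canonical tangent fields and $n_1,n_2$ normal, satisfying $\nabla'_xx=\gamma_1y+\nu n_1$, $\nabla'_xy=-\gamma_1x+\mu n_2$, $\nabla'_yx=-\gamma_2y+\mu n_2$, $\nabla'_yy=\gamma_2x-\nu n_1$, $\nabla'_xn_1=-\nu x+\beta_1n_2$, $\nabla'_yn_1=\nu y+\beta_2n_2$, $\nabla'_xn_2=-\mu y-\beta_1n_1$, $\nabla'_yn_2=-\mu x-\beta_2n_1$,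 with $\mu>0$, $\nu\ne0$, $\mu^2\ne\nu^2$; the functions $\nu,\mu,\gamma_1,\gamma_2,\beta_1,\beta_2$ are the invariants of $M^2$. Parameters $(u,v)$ are semi-canonical if the parametric lines are integral curves of the canonical tangents, with $F=0$, $x=z_u/\sqrt E$, $y=z_v/\sqrt G$; then $\gamma_1=-y(\ln\sqrt E)$, $\gamma_2=-x(\ln\sqrt G)$. *)

(* Defs.v *)
From Stdlib Require Import Reals.
Open Scope R_scope.

Record V4 := mkV4 { c0 : R; c1 : R; c2 : R; c3 : R }.

Definition vadd (a b : V4) : V4 :=
  mkV4 (c0 a + c0 b) (c1 a + c1 b) (c2 a + c2 b) (c3 a + c3 b).
Definition vscal (k : R) (a : V4) : V4 :=
  mkV4 (k * c0 a) (k * c1 a) (k * c2 a) (k * c3 a).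
Definition dot (a b : V4) : R :=
  c0 a * c0 b + c1 a * c1 b + c2 a * c2 b + c3 a * c3 b.

(* Determinant of the 4x4 matrix whose columns are a, b, c, d
   (Laplace expansion along the first row). *)
Definition det3 (a1 a2 a3 b1 b2 b3 c1' c2' c3' : R) : R :=
  a1 * (b2 * c3' - b3 * c2') - b1 * (a2 * c3' - a3 * c2') + c1' * (a2 * b3 - a3 * b2).
Definition det4 (a b c d : V4) : R :=
    c0 a * det3 (c1 b) (c2 b) (c3 b) (c1 c) (c2 c) (c3 c) (c1 d) (c2 d) (c3 d)
  - c0 b * det3 (c1 a) (c2 a) (c3 a) (c1 c) (c2 c) (c3 c) (c1 d) (c2 d) (c3 d)
  + c0 c * det3 (c1 a) (c2 a) (c3 a) (c1 b) (c2 b) (c3 b) (c1 d) (c2 d) (c3 d)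
  - c0 d * det3 (c1 a) (c2 a) (c3 a) (c1 b) (c2 b) (c3 b) (c1 c) (c2 c) (c3 c).

Definition Dom := R -> R -> Prop.

Definition open2 (U : Dom) : Prop :=
  forall u v, U u v -> exists e, 0 < e /\
    forall u' v', Rabs (u' - u) < e -> Rabs (v' - v) < e -> U u' v'.

Definition cont2 (U : Dom) (f : R -> R -> R) : Prop :=
  forall u v, U u v -> forall eps, 0 < eps -> exists d, 0 < d /\
    forall u' v', U u' v' -> Rabs (u' - u) < d -> Rabs (v' - v) < d ->
      Rabs (f u' v' - f u v) < eps.

Definition pdu (U : Dom) (f fu : R -> R -> R) : Prop :=
  forall u v, U u v -> derivable_pt_lim (fun t => f t v) u (fu u v).
Definition pdv (U : Dom) (f fv : R -> R -> R) : Prop :=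
  forall u v, U u v -> derivable_pt_lim (fun t => f u t) v (fv u v).

Fixpoint Ck (k : nat) (U : Dom) (f : R -> R -> R) : Prop :=
  match k with
  | O => cont2 U f
  | S k' => cont2 U f /\ exists fu fv, pdu U f fu /\ pdv U f fv /\
                                      Ck k' U fu /\ Ck k' U fv
  end.

Definition smooth (U : Dom) (f : R -> R -> R) : Prop := forall k, Ck k U f.

Definition comp (X : R -> R -> V4) (i : nat) : R -> R -> R :=
  fun u v => match i with
             | O => c0 (X u v) | 1%nat => c1 (X u v)
             | 2%nat => c2 (X u v) | _ => c3 (X u v) end.

Definition smoothV (U : Dom) (X : R -> R -> V4) : Prop :=
  forall i, (i < 4)%nat -> smooth U (comp X i).
Definition pduV (U : Dom) (X Xu : R -> R -> V4) : Prop :=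
  forall i, (i < 4)%nat -> pdu U (comp X i) (comp Xu i).
Definition pdvV (U : Dom) (X Xv : R -> R -> V4) : Prop :=
  forall i, (i < 4)%nat -> pdv U (comp X i) (comp Xv i).

Definition regular_surface (U : Dom) (z zu zv : R -> R -> V4) : Prop :=
  open2 U /\ smoothV U z /\ pduV U z zu /\ pdvV U z zv /\
  forall u v, U u v ->
    dot (zu u v) (zu u v) * dot (zv u v) (zv u v) - dot (zu u v) (zv u v) ^ 2 > 0.

(* {x,y,n1,n2} is a geometric frame of the surface z with invariants
   nu, mu, gamma1, gamma2, beta1, beta2.
   The flat connection along a tangent field T = a zu + b zv acting on a
   field X along the surface is  nabla'_T X = a X_u + b X_v. *)
Definition geometric_frame (U : Dom) (z : R -> R -> V4)
  (x y n1 n2 : R -> R -> V4)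
  (nu mu gamma1 gamma2 beta1 beta2 : R -> R -> R) : Prop :=
  exists zu zv : R -> R -> V4,
  regular_surface U z zu zv /\
  smoothV U x /\ smoothV U y /\ smoothV U n1 /\ smoothV U n2 /\
  exists xu xv yu yv n1u n1v n2u n2v : R -> R -> V4,
  pduV U x xu /\ pdvV U x xv /\ pduV U y yu /\ pdvV U y yv /\
  pduV U n1 n1u /\ pdvV U n1 n1v /\ pduV U n2 n2u /\ pdvV U n2 n2v /\
  exists ax bx ay by' : R -> R -> R,
  forall u v, U u v ->
    let Dx := fun Xu Xv : R -> R -> V4 =>
                vadd (vscal (ax u v) (Xu u v)) (vscal (bx u v) (Xv u v)) in
    let Dy := fun Xu Xv : R -> R -> V4 =>
                vadd (vscal (ay u v) (Xu u v)) (vscal (by' u v) (Xv u v)) in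
    x u v = vadd (vscal (ax u v) (zu u v)) (vscal (bx u v) (zv u v)) /\
    y u v = vadd (vscal (ay u v) (zu u v)) (vscal (by' u v) (zv u v)) /\
    dot (x u v) (x u v) = 1 /\ dot (y u v) (y u v) = 1 /\
    dot (n1 u v) (n1 u v) = 1 /\ dot (n2 u v) (n2 u v) = 1 /\
    dot (x u v) (y u v) = 0 /\ dot (x u v) (n1 u v) = 0 /\
    dot (x u v) (n2 u v) = 0 /\ dot (y u v) (n1 u v) = 0 /\
    dot (y u v) (n2 u v) = 0 /\ dot (n1 u v) (n2 u v) = 0 /\
    det4 (x u v) (y u v) (n1 u v) (n2 u v) > 0 /\
    Dx xu xv = vadd (vscal (gamma1 u v) (y u v)) (vscal (nu u v) (n1 u v)) /\
    Dx yu yv = vadd (vscal (- gamma1 u v) (x u v)) (vscal (mu u v) (n2 u v)) /\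
    Dy xu xv = vadd (vscal (- gamma2 u v) (y u v)) (vscal (mu u v) (n2 u v)) /\
    Dy yu yv = vadd (vscal (gamma2 u v) (x u v)) (vscal (- nu u v) (n1 u v)) /\
    Dx n1u n1v = vadd (vscal (- nu u v) (x u v)) (vscal (beta1 u v) (n2 u v)) /\
    Dy n1u n1v = vadd (vscal (nu u v) (y u v)) (vscal (beta2 u v) (n2 u v)) /\
    Dx n2u n2v = vadd (vscal (- mu u v) (y u v)) (vscal (- beta1 u v) (n1 u v)) /\
    Dy n2u n2v = vadd (vscal (- mu u v) (x u v)) (vscal (- beta2 u v) (n1 u v)) /\
    mu u v > 0 /\ nu u v <> 0 /\ mu u v ^ 2 <> nu u v ^ 2.

Definition reparametrization (W U : Dom) (p1 p2 : R -> R -> R) : Prop :=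
  open2 W /\ smooth W p1 /\ smooth W p2 /\
  (forall s t, W s t -> U (p1 s t) (p2 s t)) /\
  (forall s t s' t', W s t -> W s' t' ->
      p1 s t = p1 s' t' -> p2 s t = p2 s' t' -> s = s' /\ t = t') /\
  open2 (fun u v => exists s t, W s t /\ p1 s t = u /\ p2 s t = v) /\
  exists p1s p1t p2s p2t : R -> R -> R,
    pdu W p1 p1s /\ pdv W p1 p1t /\ pdu W p2 p2s /\ pdv W p2 p2t /\
    forall s t, W s t -> p1s s t * p2t s t - p1t s t * p2s s t <> 0.

(* Main.v *)
(** Let [theta1], [theta2] be the coframe dual to [x], [y].  For [gamma1 = 0] the structure
    equations give [d theta1 = 0] and [d theta2 = - gamma2 theta1 ^ theta2], while the Codazzi
    equations give [x(mu) = 2 gamma2 mu + beta2 nu] and [x(nu) = 2 gamma2 nu + beta2 mu], hence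
    [x(mu^2 - nu^2) = 4 gamma2 (mu^2 - nu^2)].  With [h = |mu^2 - nu^2|^(1/4)] this says
    [x(h) = gamma2 h], i.e. [d (h theta2) = 0].  By the Poincare lemma [theta1 = dS] and
    [h theta2 = dT] locally, and the inverse function theorem makes [(S, T)] coordinates, in
    which the metric is [dS^2 + h^-2 dT^2]. *)
Require Import Defs.
From Stdlib Require Import Reals Lra Lia ClassicalEpsilon.
From Coquelicot Require Import Coquelicot.
(* [Reals] redefines [c1] and [comp]. *)
Import Defs.
Open Scope R_scope.

(** * Calculus of [Ck] functions on planar open sets *)

(** Smoothness is granted to the surface and to the four frame fields; the invariants and the
    coefficients of [x], [y] in the coordinate basis are given as bare functions. The argument
    therefore works with inner products such as that of [x] and [zu], which are smooth by
    construction, recovers [mu] and [nu] as quotients of such products, and lets [gamma2] and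
    [beta2] enter through their values only. The structure and Codazzi equations come from the
    symmetry of second derivatives in flat space, in the form d(X . dY) = dX ^ dY for pairs of
    fields.

    The exponent 1/4 has its origin in the cancellation of [beta2] from mu x(mu) - nu x(nu): what
    remains makes the logarithmic derivative of mu^2 - nu^2 along [x] equal to 4 gamma2, whereas an
    integrating factor for theta2 needs gamma2. The absolute value is handled through h^8 = (mu^2 -
    nu^2)^2, which does not see the sign of mu^2 - nu^2.

    The inverse function theorem first yields only a differentiable inverse; smoothness follows
    because its partial derivatives are smooth functions of the inverse itself. *)

Lemma open2_locally (U : Dom) u v : open2 U -> U u v -> locally_2d U u v.
Proof.
intros HU Huv; destruct (HU u v Huv) as [e [He H]].
exists (mkposreal e He); exact H.
Qed.

(** [cont2] tests only points of [U], [continuity_2d_pt] all nearby points; shrinking to a square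
    inside the open set removes the difference. *)
Lemma cont2_continuity_2d (U : Dom) f : open2 U ->
  cont2 U f <-> (forall u v, U u v -> continuity_2d_pt f u v).
Proof.
intros HU; split.
- intros H u v Huv eps.
  destruct (H u v Huv eps (cond_pos eps)) as [d [Hd Hf]].
  destruct (HU u v Huv) as [e [He Hin]].
  exists (mkposreal (Rmin d e) (Rmin_pos _ _ Hd He)); simpl; intros u' v' Hu' Hv'.
  pose proof (Rmin_l d e); pose proof (Rmin_r d e).
  apply Hf; [apply Hin | |]; lra.
- intros H u v Huv eps Heps.
  destruct (H u v Huv (mkposreal eps Heps)) as [d Hd].
  exists d; split; [apply cond_pos|intros; now apply Hd].
Qed.

Lemma derivable_pt_lim_locally_ext f g x l :
  locally x (fun t => f t = g t) -> derivable_pt_lim f x l -> derivable_pt_lim g x l.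
Proof.
intros Hloc H; apply is_derive_Reals; apply is_derive_Reals in H.
exact (is_derive_ext_loc f g x l Hloc H).
Qed.

Lemma pdu_ext (U : Dom) f g fu gu : open2 U ->
  (forall u v, U u v -> f u v = g u v) -> (forall u v, U u v -> fu u v = gu u v) ->
  pdu U f fu -> pdu U g gu.
Proof.
intros HU Hfg Hd H u v Huv; rewrite <- (Hd u v Huv).
apply derivable_pt_lim_locally_ext with (2 := H u v Huv).
apply locally_2d_1d_const_y with (P := fun s t => f s t = g s t).
generalize (open2_locally _ _ _ HU Huv); apply locally_2d_impl, locally_2d_forall; auto.
Qed.

Lemma pdv_ext (U : Dom) f g fv gv : open2 U ->
  (forall u v, U u v -> f u v = g u v) -> (forall u v, U u v -> fv u v = gv u v) ->
  pdv U f fv -> pdv U g gv.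
Proof.
intros HU Hfg Hd H u v Huv; rewrite <- (Hd u v Huv).
apply derivable_pt_lim_locally_ext with (2 := H u v Huv).
apply locally_2d_1d_const_x with (P := fun s t => f s t = g s t).
generalize (open2_locally _ _ _ HU Huv); apply locally_2d_impl, locally_2d_forall; auto.
Qed.

Lemma pdu_unique (U : Dom) f fu gu : pdu U f fu -> pdu U f gu ->
  forall u v, U u v -> fu u v = gu u v.
Proof. intros H1 H2 u v Huv; eapply uniqueness_limite; [apply H1 | apply H2]; auto. Qed.

Lemma pdv_unique (U : Dom) f fv gv : pdv U f fv -> pdv U f gv ->
  forall u v, U u v -> fv u v = gv u v.
Proof. intros H1 H2 u v Huv; eapply uniqueness_limite; [apply H1 | apply H2]; auto. Qed.

Lemma pdu_plus (U : Dom) f g fu gu : pdu U f fu -> pdu U g gu ->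
  pdu U (fun u v => f u v + g u v) (fun u v => fu u v + gu u v).
Proof. intros Hf Hg u v Huv; apply derivable_pt_lim_plus; auto. Qed.

Lemma pdv_plus (U : Dom) f g fv gv : pdv U f fv -> pdv U g gv ->
  pdv U (fun u v => f u v + g u v) (fun u v => fv u v + gv u v).
Proof. intros Hf Hg u v Huv; apply derivable_pt_lim_plus; auto. Qed.

Lemma pdu_mult (U : Dom) f g fu gu : pdu U f fu -> pdu U g gu ->
  pdu U (fun u v => f u v * g u v) (fun u v => fu u v * g u v + f u v * gu u v).
Proof.
intros Hf Hg u v Huv.
apply (derivable_pt_lim_mult (fun t => f t v) (fun t => g t v)); auto.
Qed.

Lemma pdv_mult (U : Dom) f g fv gv : pdv U f fv -> pdv U g gv ->
  pdv U (fun u v => f u v * g u v) (fun u v => fv u v * g u v + f u v * gv u v).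
Proof.
intros Hf Hg u v Huv.
apply (derivable_pt_lim_mult (fun t => f u t) (fun t => g u t)); auto.
Qed.

Lemma pdu_comp1 (U : Dom) phi phi' f fu :
  (forall u v, U u v -> derivable_pt_lim phi (f u v) (phi' (f u v))) -> pdu U f fu ->
  pdu U (fun u v => phi (f u v)) (fun u v => phi' (f u v) * fu u v).
Proof.
intros Hp Hf u v Huv.
apply (derivable_pt_lim_comp (fun t => f t v) phi); auto.
Qed.

Lemma pdv_comp1 (U : Dom) phi phi' f fv :
  (forall u v, U u v -> derivable_pt_lim phi (f u v) (phi' (f u v))) -> pdv U f fv ->
  pdv U (fun u v => phi (f u v)) (fun u v => phi' (f u v) * fv u v).
Proof.
intros Hp Hf u v Huv.
apply (derivable_pt_lim_comp (fun t => f u t) phi); auto.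
Qed.

Lemma derivable_pt_lim_inv_id x : x <> 0 -> derivable_pt_lim Rinv x (- / x * / x).
Proof.
intros Hx; apply is_derive_Reals.
replace (- / x * / x) with (- 1 / x ^ 2) by (field; exact Hx).
apply (is_derive_inv (fun t => t)); [apply (is_derive_id x) | exact Hx].
Qed.

Lemma Ck_cont k (U : Dom) f : Ck k U f -> cont2 U f.
Proof. destruct k; simpl; tauto. Qed.

Lemma Ck_S k (U : Dom) f : Ck (S k) U f -> Ck k U f.
Proof.
revert f; induction k as [|k IH]; intros f [Hc Hd]; [exact Hc|].
split; [exact Hc|].
destruct Hd as [fu [fv [Hu [Hv [Cu Cv]]]]].
exists fu, fv; repeat split; auto.
Qed.

Lemma cont2_ext (U : Dom) f g : (forall u v, U u v -> f u v = g u v) ->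
  cont2 U f -> cont2 U g.
Proof.
intros Hfg H u v Huv eps Heps.
destruct (H u v Huv eps Heps) as [d [Hd Hf]].
exists d; split; [exact Hd|]; intros u' v' HU' Hu' Hv'.
rewrite <- !Hfg by assumption; auto.
Qed.

Lemma Ck_ext k (U : Dom) f g : open2 U -> (forall u v, U u v -> f u v = g u v) ->
  Ck k U f -> Ck k U g.
Proof.
intros HU Hfg; destruct k as [|k]; [now apply cont2_ext|].
intros [Hc [fu [fv [Hu [Hv C]]]]].
split; [now apply cont2_ext with f|].
exists fu, fv; split; [now apply pdu_ext with f fu|].
split; [now apply pdv_ext with f fv|exact C].
Qed.

Lemma cont2_restrict (U W : Dom) f : (forall u v, W u v -> U u v) -> cont2 U f -> cont2 W f.
Proof.
intros HW H u v Huv eps Heps.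
destruct (H u v (HW _ _ Huv) eps Heps) as [d [Hd Hf]]; exists d; auto.
Qed.

Lemma cont2_pointwise (U : Dom) f : open2 U -> cont2 U f ->
  forall u v, U u v -> continuity_2d_pt f u v.
Proof. intros HU; apply cont2_continuity_2d; exact HU. Qed.

Lemma Ck_const k (U : Dom) a : Ck k U (fun _ _ => a).
Proof.
revert a; induction k as [|k IH]; intros a.
- intros u v _ eps Heps; exists 1; split; [lra|]; intros.
  unfold Rminus; rewrite Rplus_opp_r, Rabs_R0; exact Heps.
- split; [exact (Ck_cont k U _ (IH a))|].
  exists (fun _ _ => 0), (fun _ _ => 0); repeat split; auto;
    intros u v _; apply derivable_pt_lim_const.
Qed.

(** * Algebra of [Ck] and smooth functions on a fixed open set *)

Section OpenDomain.
Variable U : Dom.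
Hypothesis HU : open2 U.

Lemma Ck_plus k f g : Ck k U f -> Ck k U g -> Ck k U (fun u v => f u v + g u v).
Proof.
assert (C0 : forall f g, cont2 U f -> cont2 U g -> cont2 U (fun u v => f u v + g u v)).
{ intros f' g' Hf Hg; apply cont2_continuity_2d; [exact HU|]; intros u v Huv.
  apply continuity_2d_pt_plus; apply cont2_pointwise with U; auto. }
revert f g; induction k as [|k IH]; intros f g; [apply C0|].
intros [Hf [fu [fv [Fu [Fv [Cfu Cfv]]]]]] [Hg [gu [gv [Gu [Gv [Cgu Cgv]]]]]].
split; [now apply C0|].
exists (fun u v => fu u v + gu u v), (fun u v => fv u v + gv u v).
split; [now apply pdu_plus|]; split; [now apply pdv_plus|]; auto.
Qed.

Lemma Ck_mult k f g : Ck k U f -> Ck k U g -> Ck k U (fun u v => f u v * g u v).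
Proof.
assert (C0 : forall f g, cont2 U f -> cont2 U g -> cont2 U (fun u v => f u v * g u v)).
{ intros f' g' Hf Hg; apply cont2_continuity_2d; [exact HU|]; intros u v Huv.
  apply continuity_2d_pt_mult; apply cont2_pointwise with U; auto. }
revert f g; induction k as [|k IH]; intros f g; [apply C0|].
intros Sf Sg; pose proof (Ck_S _ _ _ Sf) as Tf; pose proof (Ck_S _ _ _ Sg) as Tg.
destruct Sf as [Hf [fu [fv [Fu [Fv [Cfu Cfv]]]]]].
destruct Sg as [Hg [gu [gv [Gu [Gv [Cgu Cgv]]]]]].
split; [now apply C0|].
exists (fun u v => fu u v * g u v + f u v * gu u v),
       (fun u v => fv u v * g u v + f u v * gv u v).
split; [now apply pdu_mult|]; split; [now apply pdv_mult|].
split; apply Ck_plus; auto.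
Qed.

(** The second hypothesis may use the regularity of [phi] composed with [f] at the same lower order.
    This suits functions whose derivative is an expression in themselves, such as the inverse and
    the square root, and makes the induction self-supporting. *)
Lemma Ck_comp1 (phi phi' : R -> R) k f :
  (forall u v, U u v -> derivable_pt_lim phi (f u v) (phi' (f u v))) ->
  (forall j, (j < k)%nat -> Ck j U (fun u v => phi (f u v)) ->
     Ck j U f -> Ck j U (fun u v => phi' (f u v))) ->
  Ck k U f -> Ck k U (fun u v => phi (f u v)).
Proof.
intros Hphi; induction k as [|k IH]; intros Hj Hf.
- apply cont2_continuity_2d; [exact HU|]; intros u v Huv.
  apply continuity_1d_2d_pt_comp; [|now apply cont2_pointwise with U].
  apply derivable_continuous_pt; exists (phi' (f u v)); now apply Hphi.
- assert (Tf := Ck_S _ _ _ Hf).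
  assert (Tp : Ck k U (fun u v => phi (f u v))) by (apply IH; auto).
  split; [exact (Ck_cont _ _ _ Tp)|].
  destruct Hf as [Hf [fu [fv [Fu [Fv [Cfu Cfv]]]]]].
  exists (fun u v => phi' (f u v) * fu u v), (fun u v => phi' (f u v) * fv u v).
  split; [now apply pdu_comp1|]; split; [now apply pdv_comp1|].
  split; apply Ck_mult; auto.
Qed.

Lemma Ck_inv k f : (forall u v, U u v -> f u v <> 0) ->
  Ck k U f -> Ck k U (fun u v => / f u v).
Proof.
intros Hnz; apply (Ck_comp1 Rinv (fun t => - / t * / t)).
- intros; apply derivable_pt_lim_inv_id; auto.
- intros j _ H _.
  apply Ck_ext with (fun u v => (-1) * / f u v * / f u v); [exact HU|intros; ring|].
  repeat apply Ck_mult; auto; apply Ck_const.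
Qed.

Lemma Ck_sqrt k f : (forall u v, U u v -> 0 < f u v) ->
  Ck k U f -> Ck k U (fun u v => sqrt (f u v)).
Proof.
intros Hpos; apply (Ck_comp1 sqrt (fun t => / (2 * sqrt t))).
- intros; apply derivable_pt_lim_sqrt; auto.
- intros j _ H _; apply Ck_inv.
  + intros u v Huv; pose proof (sqrt_lt_R0 _ (Hpos u v Huv)); lra.
  + apply Ck_mult; [apply Ck_const|exact H].
Qed.

Lemma smooth_ext f g : (forall u v, U u v -> f u v = g u v) -> smooth U f -> smooth U g.
Proof. intros H Hf k; apply Ck_ext with f; auto. Qed.

Lemma smooth_const a : smooth U (fun _ _ => a).
Proof. intros k; apply Ck_const. Qed.

Lemma smooth_plus f g : smooth U f -> smooth U g -> smooth U (fun u v => f u v + g u v).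
Proof. intros Hf Hg k; apply Ck_plus; auto. Qed.

Lemma smooth_mult f g : smooth U f -> smooth U g -> smooth U (fun u v => f u v * g u v).
Proof. intros Hf Hg k; apply Ck_mult; auto. Qed.

Lemma smooth_opp f : smooth U f -> smooth U (fun u v => - f u v).
Proof.
intros Hf; apply smooth_ext with (fun u v => (-1) * f u v); [intros; ring|].
apply smooth_mult; auto using smooth_const.
Qed.

Lemma smooth_minus f g : smooth U f -> smooth U g -> smooth U (fun u v => f u v - g u v).
Proof. intros Hf Hg; apply smooth_plus; [|apply smooth_opp]; auto. Qed.

Lemma smooth_div f g : smooth U f -> smooth U g -> (forall u v, U u v -> g u v <> 0) ->
  smooth U (fun u v => f u v / g u v).
Proof. intros Hf Hg Hnz k; apply Ck_mult; [|apply Ck_inv]; auto. Qed.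

Lemma smooth_sqrt f : smooth U f -> (forall u v, U u v -> 0 < f u v) ->
  smooth U (fun u v => sqrt (f u v)).
Proof. intros Hf Hpos k; apply Ck_sqrt; auto. Qed.

(** [Ck] hides its partial derivatives behind an existential, possibly with different witnesses at
    each order; uniqueness of derivatives identifies them all with [fu] on [U]. *)
Lemma smooth_pdu f fu : smooth U f -> pdu U f fu -> smooth U fu.
Proof.
intros Hf Hu k; destruct (Hf (S k)) as [_ [gu [gv [Gu [_ [C _]]]]]].
apply Ck_ext with gu; [exact HU| |exact C].
now apply pdu_unique with f.
Qed.

Lemma smooth_pdv f fv : smooth U f -> pdv U f fv -> smooth U fv.
Proof.
intros Hf Hv k; destruct (Hf (S k)) as [_ [gu [gv [_ [Gv [_ C]]]]]].
apply Ck_ext with gv; [exact HU| |exact C].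
now apply pdv_unique with f.
Qed.

Lemma smooth_ex_pdu f : smooth U f -> exists fu, pdu U f fu.
Proof. intros Hf; destruct (Hf 1%nat) as [_ [fu [fv [H _]]]]; eauto. Qed.

Lemma smooth_ex_pdv f : smooth U f -> exists fv, pdv U f fv.
Proof. intros Hf; destruct (Hf 1%nat) as [_ [fu [fv [_ [H _]]]]]; eauto. Qed.

Lemma smooth_cont f : smooth U f -> cont2 U f.
Proof. intros Hf; exact (Hf 0%nat). Qed.

Lemma pdu_Derive f fu u v : pdu U f fu -> U u v ->
  locally_2d (fun s t => Derive (fun a => f a t) s = fu s t) u v.
Proof.
intros Hf Huv; generalize (open2_locally _ _ _ HU Huv).
apply locally_2d_impl, locally_2d_forall; intros s t Hst.
apply is_derive_unique, is_derive_Reals, Hf, Hst.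
Qed.

Lemma pdv_Derive f fv u v : pdv U f fv -> U u v ->
  locally_2d (fun s t => Derive (fun a => f s a) t = fv s t) u v.
Proof.
intros Hf Huv; generalize (open2_locally _ _ _ HU Huv).
apply locally_2d_impl, locally_2d_forall; intros s t Hst.
apply is_derive_unique, is_derive_Reals, Hf, Hst.
Qed.

(** This is Schwarz's theorem, carried from total [Derive] to relational partials: on a
    neighbourhood inside [U] the two notions agree, so they have the same derivatives and the same
    continuity there. *)
Lemma mixed_partials f fu fv fuv fvu :
  pdu U f fu -> pdv U f fv -> pdv U fu fuv -> pdu U fv fvu ->
  cont2 U fuv -> cont2 U fvu -> forall u v, U u v -> fuv u v = fvu u v.
Proof.
intros Hu Hv Huv Hvu Cuv Cvu u v Uuv.
assert (HDvu : forall s t, U s t ->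
  is_derive (fun z => Derive (fun a => f z a) t) s (fvu s t)).
{ intros s t Hst; apply (is_derive_ext_loc (fun z => fv z t)).
  - generalize (locally_2d_1d_const_y _ _ _ (pdv_Derive _ _ _ _ Hv Hst)).
    apply filter_imp; intros; symmetry; assumption.
  - apply is_derive_Reals, Hvu, Hst. }
assert (HDuv : forall s t, U s t ->
  is_derive (fun z => Derive (fun a => f a z) s) t (fuv s t)).
{ intros s t Hst; apply (is_derive_ext_loc (fun z => fu s z)).
  - generalize (locally_2d_1d_const_x _ _ _ (pdu_Derive _ _ _ _ Hu Hst)).
    apply filter_imp; intros; symmetry; assumption.
  - apply is_derive_Reals, Huv, Hst. }
rewrite <- (is_derive_unique _ _ _ (HDvu u v Uuv)), <- (is_derive_unique _ _ _ (HDuv u v Uuv)).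
symmetry; apply Schwarz.
- generalize (open2_locally _ _ _ HU Uuv).
  apply locally_2d_impl, locally_2d_forall; intros s t Hst; repeat split.
  + exists (fu s t); apply is_derive_Reals, Hu, Hst.
  + exists (fv s t); apply is_derive_Reals, Hv, Hst.
  + exists (fvu s t); apply HDvu, Hst.
  + exists (fuv s t); apply HDuv, Hst.
- apply continuity_2d_pt_ext_loc with fvu; [|now apply cont2_pointwise with U].
  generalize (open2_locally _ _ _ HU Uuv).
  apply locally_2d_impl, locally_2d_forall; intros s t Hst.
  symmetry; apply is_derive_unique, HDvu, Hst.
- apply continuity_2d_pt_ext_loc with fuv; [|now apply cont2_pointwise with U].
  generalize (open2_locally _ _ _ HU Uuv).
  apply locally_2d_impl, locally_2d_forall; intros s t Hst.
  symmetry; apply is_derive_unique, HDuv, Hst.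
Qed.

End OpenDomain.

(** * Total differentiability, composition and the Poincare lemma *)

(** A ball of the sup norm. Two of its points are joined inside it by one horizontal and one
    vertical segment, which is how bounds on partial derivatives become Lipschitz bounds. *)
Definition box (a b r : R) : Dom := fun u v => Rabs (u - a) < r /\ Rabs (v - b) < r.

Lemma open2_box a b r : open2 (box a b r).
Proof.
intros u v [Hu Hv]; exists (Rmin (r - Rabs (u - a)) (r - Rabs (v - b))).
split; [apply Rmin_pos; lra|]; intros u' v' Hu' Hv'.
pose proof (Rmin_l (r - Rabs (u - a)) (r - Rabs (v - b))).
pose proof (Rmin_r (r - Rabs (u - a)) (r - Rabs (v - b))).
split.
- replace (u' - a) with ((u' - u) + (u - a)) by ring.
  pose proof (Rabs_triang (u' - u) (u - a)); lra.
- replace (v' - b) with ((v' - v) + (v - b)) by ring.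
  pose proof (Rabs_triang (v' - v) (v - b)); lra.
Qed.

Lemma open2_box_inside (U : Dom) a b : open2 U -> U a b ->
  exists r, 0 < r /\ forall u v, box a b r u v -> U u v.
Proof.
intros HU Hab; destruct (HU a b Hab) as [e [He H]]; exists e; split; [exact He|].
intros u v [Hu Hv]; auto.
Qed.

Lemma box_center a b r : 0 < r -> box a b r a b.
Proof. intros Hr; split; unfold Rminus; rewrite Rplus_opp_r, Rabs_R0; exact Hr. Qed.

Lemma between_dist a b c t : Rmin a b <= t <= Rmax a b ->
  Rabs (t - c) <= Rmax (Rabs (a - c)) (Rabs (b - c)).
Proof.
unfold Rmin, Rmax, Rabs; intros H.
repeat match goal with
  | H : context [Rle_dec ?x ?y] |- _ => destruct (Rle_dec x y)
  | |- context [Rle_dec ?x ?y] => destruct (Rle_dec x y)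
  | |- context [Rcase_abs ?x] => destruct (Rcase_abs x)
  | H : context [Rcase_abs ?x] |- _ => destruct (Rcase_abs x)
  end; lra.
Qed.

Lemma box_between_u a b r u u' v t : box a b r u v -> box a b r u' v ->
  Rmin u u' <= t <= Rmax u u' -> box a b r t v.
Proof.
intros [Hu Hv] [Hu' _] Ht; split; [|exact Hv].
eapply Rle_lt_trans; [apply between_dist, Ht|]; now apply Rmax_lub_lt.
Qed.

Lemma box_between_v a b r u v v' t : box a b r u v -> box a b r u v' ->
  Rmin v v' <= t <= Rmax v v' -> box a b r u t.
Proof.
intros [Hu Hv] [_ Hv'] Ht; split; [exact Hu|].
eapply Rle_lt_trans; [apply between_dist, Ht|]; now apply Rmax_lub_lt.
Qed.

Lemma derivative_bound_lipschitz f df a b k :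
  (forall t, Rmin a b <= t <= Rmax a b -> derivable_pt_lim f t (df t) /\ Rabs (df t) <= k) ->
  Rabs (f b - f a) <= k * Rabs (b - a).
Proof.
intros H; destruct (MVT_gen f a b df) as [c [Hc Heq]].
- intros t Ht; apply is_derive_Reals, H; lra.
- intros t Ht; apply derivable_continuous_pt; exists (df t); now apply H.
- rewrite Heq, Rabs_mult; apply Rmult_le_compat_r; [apply Rabs_pos|now apply H].
Qed.

Lemma box_lipschitz f fu fv a b r k :
  pdu (box a b r) f fu -> pdv (box a b r) f fv ->
  (forall u v, box a b r u v -> Rabs (fu u v) <= k /\ Rabs (fv u v) <= k) ->
  forall u v u' v', box a b r u v -> box a b r u' v' ->
  Rabs (f u' v' - f u v) <= k * (Rabs (u' - u) + Rabs (v' - v)).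
Proof.
intros Hu Hv Hk u v u' v' B B'.
assert (B1 : box a b r u' v) by (destruct B, B'; split; assumption).
replace (f u' v' - f u v) with ((f u' v - f u v) + (f u' v' - f u' v)) by ring.
eapply Rle_trans; [apply Rabs_triang|]; rewrite Rmult_plus_distr_l.
apply Rplus_le_compat.
- apply (derivative_bound_lipschitz (fun t => f t v) (fun t => fu t v)).
  intros t Ht; pose proof (box_between_u _ _ _ _ _ _ _ B B1 Ht).
  split; [now apply Hu|now apply Hk].
- apply (derivative_bound_lipschitz (fun t => f u' t) (fun t => fv u' t)).
  intros t Ht; pose proof (box_between_v _ _ _ _ _ _ _ B1 B' Ht).
  split; [now apply Hv|now apply Hk].
Qed.

Lemma pdu_restrict (U W : Dom) f fu : (forall u v, W u v -> U u v) -> pdu U f fu -> pdu W f fu.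
Proof. intros H Hf u v Huv; auto. Qed.

Lemma pdv_restrict (U W : Dom) f fv : (forall u v, W u v -> U u v) -> pdv U f fv -> pdv W f fv.
Proof. intros H Hf u v Huv; auto. Qed.

Lemma pdu_linear (U : Dom) p q : pdu U (fun u v => p * u + q * v) (fun _ _ => p).
Proof.
intros u v _; apply is_derive_Reals; auto_derive; [exact I|ring].
Qed.

Lemma pdv_linear (U : Dom) p q : pdv U (fun u v => p * u + q * v) (fun _ _ => q).
Proof.
intros u v _; apply is_derive_Reals; auto_derive; [exact I|ring].
Qed.

(** Subtracting the linear part frozen at [(u, v)] leaves a function whose partials are at most
    [eps / 2] on a small square. The half absorbs the passage from the sum of the two increments to
    twice their maximum. *)
Lemma differentiable_of_partials (U : Dom) f fu fv : open2 U ->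
  pdu U f fu -> pdv U f fv -> cont2 U fu -> cont2 U fv ->
  forall u v, U u v -> differentiable_pt_lim f u v (fu u v) (fv u v).
Proof.
intros HU Hu Hv Cu Cv u v Huv eps.
assert (He : 0 < eps / 2) by (destruct eps; simpl; lra).
destruct (Cu u v Huv _ He) as [d1 [Hd1 H1]].
destruct (Cv u v Huv _ He) as [d2 [Hd2 H2]].
destruct (open2_box_inside U u v HU Huv) as [d3 [Hd3 H3]].
set (d := Rmin d1 (Rmin d2 d3)).
assert (Hd : 0 < d) by (repeat apply Rmin_pos; assumption).
assert (L1 : d <= d1) by apply Rmin_l.
assert (L2 : d <= d2) by (eapply Rle_trans; [apply Rmin_r|apply Rmin_l]).
assert (L3 : d <= d3) by (eapply Rle_trans; [apply Rmin_r|apply Rmin_r]).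
assert (HB : forall s t, box u v d s t -> U s t)
  by (intros s t [Hs Ht]; apply H3; split; lra).
exists (mkposreal d Hd); simpl; intros s t Hs Ht.
pose (g := fun s t => f s t + (- fu u v * s + - fv u v * t)).
assert (Hg : Rabs (g s t - g u v) <= eps / 2 * (Rabs (s - u) + Rabs (t - v))).
{ apply (box_lipschitz g (fun s t => fu s t + - fu u v) (fun s t => fv s t + - fv u v) u v d).
  - apply pdu_plus; [now apply pdu_restrict with U|apply pdu_linear].
  - apply pdv_plus; [now apply pdv_restrict with U|apply pdv_linear].
  - intros s' t' B; pose proof (HB _ _ B); destruct B as [Bs Bt].
    split; apply Rlt_le; [apply H1|apply H2]; auto; lra.
  - now apply box_center.
  - now split. }
replace (f s t - f u v - (fu u v * (s - u) + fv u v * (t - v))) with (g s t - g u v)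
  by (unfold g; ring).
eapply Rle_trans; [exact Hg|].
pose proof (Rmax_l (Rabs (s - u)) (Rabs (t - v))).
pose proof (Rmax_r (Rabs (s - u)) (Rabs (t - v))).
replace (eps * Rmax (Rabs (s - u)) (Rabs (t - v)))
  with (eps / 2 * (2 * Rmax (Rabs (s - u)) (Rabs (t - v)))) by field.
apply Rmult_le_compat_l; lra.
Qed.

Lemma derivable_pt_lim_along_u f u v lu lv :
  differentiable_pt_lim f u v lu lv -> derivable_pt_lim (fun t => f t v) u lu.
Proof.
intros H; replace lu with (lu * 1 + lv * 0) by ring.
apply (derivable_pt_lim_comp_2d f (fun t => t) (fun _ => v)); [exact H| |].
- apply derivable_pt_lim_id.
- apply derivable_pt_lim_const.
Qed.

Lemma derivable_pt_lim_along_v f u v lu lv :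
  differentiable_pt_lim f u v lu lv -> derivable_pt_lim (fun t => f u t) v lv.
Proof.
intros H; replace lv with (lu * 0 + lv * 1) by ring.
apply (derivable_pt_lim_comp_2d f (fun _ => u) (fun t => t)); [exact H| |].
- apply derivable_pt_lim_const.
- apply derivable_pt_lim_id.
Qed.

(** * Chain rule and regularity under a change of variables *)

Section Composition.
Variables (U W : Dom) (p1 p2 : R -> R -> R).
Hypothesis HU : open2 U.
Hypothesis HW : open2 W.
Hypothesis Hp : forall s t, W s t -> U (p1 s t) (p2 s t).

Lemma cont2_comp f : cont2 U f -> cont2 W p1 -> cont2 W p2 ->
  cont2 W (fun s t => f (p1 s t) (p2 s t)).
Proof.
intros Hf H1 H2 s t Hst eps Heps.
destruct (Hf _ _ (Hp s t Hst) eps Heps) as [d [Hd Hfd]].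
destruct (H1 s t Hst d Hd) as [d1 [Hd1 K1]].
destruct (H2 s t Hst d Hd) as [d2 [Hd2 K2]].
exists (Rmin d1 d2); split; [now apply Rmin_pos|]; intros s' t' Hst' Hs Ht.
pose proof (Rmin_l d1 d2); pose proof (Rmin_r d1 d2).
apply Hfd; [now apply Hp|apply K1|apply K2]; auto; lra.
Qed.

Lemma pdu_comp f fu fv p1s p2s : pdu U f fu -> pdv U f fv -> cont2 U fu -> cont2 U fv ->
  pdu W p1 p1s -> pdu W p2 p2s ->
  pdu W (fun s t => f (p1 s t) (p2 s t))
    (fun s t => fu (p1 s t) (p2 s t) * p1s s t + fv (p1 s t) (p2 s t) * p2s s t).
Proof.
intros Hu Hv Cu Cv H1 H2 s t Hst.
apply (derivable_pt_lim_comp_2d f (fun a => p1 a t) (fun a => p2 a t)); auto.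
now apply differentiable_of_partials with U; auto.
Qed.

Lemma pdv_comp f fu fv p1t p2t : pdu U f fu -> pdv U f fv -> cont2 U fu -> cont2 U fv ->
  pdv W p1 p1t -> pdv W p2 p2t ->
  pdv W (fun s t => f (p1 s t) (p2 s t))
    (fun s t => fu (p1 s t) (p2 s t) * p1t s t + fv (p1 s t) (p2 s t) * p2t s t).
Proof.
intros Hu Hv Cu Cv H1 H2 s t Hst.
apply (derivable_pt_lim_comp_2d f (fun a => p1 s a) (fun a => p2 s a)); auto.
now apply differentiable_of_partials with U; auto.
Qed.

Lemma Ck_comp k f : Ck k U f -> Ck k W p1 -> Ck k W p2 ->
  Ck k W (fun s t => f (p1 s t) (p2 s t)).
Proof.
revert f; induction k as [|k IH]; intros f Hf H1 H2; [now apply cont2_comp|].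
assert (T1 := Ck_S _ _ _ H1); assert (T2 := Ck_S _ _ _ H2).
destruct Hf as [Cf [fu [fv [Fu [Fv [Cu Cv]]]]]].
destruct H1 as [C1 [p1s [p1t [P1s [P1t [C1s C1t]]]]]].
destruct H2 as [C2 [p2s [p2t [P2s [P2t [C2s C2t]]]]]].
split; [now apply cont2_comp|].
exists (fun s t => fu (p1 s t) (p2 s t) * p1s s t + fv (p1 s t) (p2 s t) * p2s s t),
       (fun s t => fu (p1 s t) (p2 s t) * p1t s t + fv (p1 s t) (p2 s t) * p2t s t).
split; [apply pdu_comp; auto; now apply Ck_cont with k|].
split; [apply pdv_comp; auto; now apply Ck_cont with k|].
split; apply Ck_plus; auto; apply Ck_mult; auto.
Qed.

(* Bootstrapping: the right-hand sides gain one derivative from each derivative of [p]. *)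
Lemma smooth_solution a1s a1t a2s a2t :
  cont2 W p1 -> cont2 W p2 ->
  smooth U a1s -> smooth U a1t -> smooth U a2s -> smooth U a2t ->
  pdu W p1 (fun s t => a1s (p1 s t) (p2 s t)) -> pdv W p1 (fun s t => a1t (p1 s t) (p2 s t)) ->
  pdu W p2 (fun s t => a2s (p1 s t) (p2 s t)) -> pdv W p2 (fun s t => a2t (p1 s t) (p2 s t)) ->
  smooth W p1 /\ smooth W p2.
Proof.
intros C1 C2 A1s A1t A2s A2t D1s D1t D2s D2t.
cut (forall k, Ck k W p1 /\ Ck k W p2); [intros H; split; intros k; apply H|].
induction k as [|k [IH1 IH2]]; [now split|].
split; split; auto.
- exists (fun s t => a1s (p1 s t) (p2 s t)), (fun s t => a1t (p1 s t) (p2 s t)).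
  repeat split; auto; apply Ck_comp; auto.
- exists (fun s t => a2s (p1 s t) (p2 s t)), (fun s t => a2t (p1 s t) (p2 s t)).
  repeat split; auto; apply Ck_comp; auto.
Qed.

End Composition.

(** * Closed one-forms on a square are exact *)

Lemma continuity_2d_slice_u f u v : continuity_2d_pt f u v -> continuous (fun t => f t v) u.
Proof.
intros H; apply continuity_pt_filterlim; intros eps Heps.
destruct (H (mkposreal eps Heps)) as [d Hd].
exists d; split; [apply cond_pos|]; intros t [_ Ht]; apply Hd; [exact Ht|].
unfold Rminus; rewrite Rplus_opp_r, Rabs_R0; apply cond_pos.
Qed.

Lemma continuity_2d_slice_v f u v : continuity_2d_pt f u v -> continuous (fun t => f u t) v.
Proof.
intros H; apply continuity_pt_filterlim; intros eps Heps.
destruct (H (mkposreal eps Heps)) as [d Hd].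
exists d; split; [apply cond_pos|]; intros t [_ Ht]; apply Hd; [|exact Ht].
unfold Rminus; rewrite Rplus_opp_r, Rabs_R0; apply cond_pos.
Qed.

(** The potential integrates [P du + Q dv] from [(a, b)] horizontally to [(u, b)], then vertically
    to [(u, v)]. Its [v]-derivative is the integrand at the endpoint. For the [u]-derivative,
    differentiation under the second integral produces [Qu], which closedness turns into [Pv], whose
    integral is [P u v - P u b]; the first integral supplies the missing [P u b]. *)
Lemma poincare_box a b r P Q Pv Qu : 0 < r ->
  cont2 (box a b r) P -> cont2 (box a b r) Q ->
  cont2 (box a b r) Pv -> cont2 (box a b r) Qu ->
  pdv (box a b r) P Pv -> pdu (box a b r) Q Qu ->
  (forall u v, box a b r u v -> Pv u v = Qu u v) ->
  exists S, pdu (box a b r) S P /\ pdv (box a b r) S Q.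
Proof.
intros Hr CP CQ CPv CQu DP DQ Heq.
set (B := box a b r) in *.
assert (HB : open2 B) by apply open2_box.
assert (Bu : forall u v, B u v -> B u b).
{ intros u v [Hu _]; split; [exact Hu|]; now apply (box_center a b r). }
assert (Ba : forall u v, B u v -> B a v).
{ intros u v [_ Hv]; split; [|exact Hv]; now apply (box_center a b r). }
assert (EP : forall u v, B u v -> ex_RInt (fun t => P t b) a u).
{ intros u v Huv; apply (ex_RInt_continuous (fun t => P t b)); intros t Ht.
  apply continuity_2d_slice_u, cont2_pointwise with B; auto.
  apply (box_between_u a b r a u b t); [apply (Ba u b)| |exact Ht]; apply (Bu u v Huv). }
assert (EQ : forall u v, B u v -> ex_RInt (fun t => Q u t) b v).
{ intros u v Huv; apply (ex_RInt_continuous (fun t => Q u t)); intros t Ht.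
  apply continuity_2d_slice_v, cont2_pointwise with B; auto.
  apply (box_between_v a b r u b v t); [apply (Bu u v)| |exact Ht]; exact Huv. }
exists (fun u v => RInt (fun t => P t b) a u + RInt (fun t => Q u t) b v).
split.
- intros u v Huv.
  replace (P u v) with (P u b + (P u v - P u b)) by ring.
  apply derivable_pt_lim_plus; apply is_derive_Reals.
  + apply (is_derive_RInt (fun t => P t b) (fun w => RInt (fun t => P t b) a w) a u).
    * generalize (locally_2d_1d_const_y _ _ _ (open2_locally B u b HB (Bu u v Huv))).
      apply filter_imp; intros w Hw; apply (RInt_correct (fun t => P t b)), (EP w b Hw).
    * apply continuity_2d_slice_u, cont2_pointwise with B; eauto.
  + assert (Hseg : forall t, Rmin b v <= t <= Rmax b v -> B u t).
    { intros t Ht; exact (box_between_v a b r u b v t (Bu u v Huv) Huv Ht). }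
    assert (HI : is_RInt (fun t => Derive (fun w => Q w t) u) b v (P u v - P u b)).
    { apply (is_RInt_ext (fun t => Pv u t)).
      - intros t Ht; symmetry; apply is_derive_unique.
        assert (Bt : B u t) by (apply Hseg; lra).
        rewrite (Heq u t Bt); apply is_derive_Reals, DQ, Bt.
      - apply (is_RInt_derive (fun t => P u t)).
        + intros t Ht; apply is_derive_Reals, DP, Hseg, Ht.
        + intros t Ht; apply continuity_2d_slice_v, cont2_pointwise with B; auto. }
    rewrite <- (is_RInt_unique _ _ _ _ HI).
    apply (is_derive_RInt_param Q).
    * generalize (locally_2d_1d_const_y _ _ _ (open2_locally B u v HB Huv)).
      apply filter_imp; intros w Hw t Ht.
      exists (Qu w t); apply is_derive_Reals, DQ.
      exact (box_between_v a b r w b v t (Bu w v Hw) Hw Ht).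
    * intros t Ht; apply continuity_2d_pt_ext_loc with Qu.
      -- generalize (pdu_Derive B HB Q Qu u t DQ (Hseg t Ht)).
         apply locally_2d_impl, locally_2d_forall; intros; symmetry; assumption.
      -- apply cont2_pointwise with B; auto.
    * generalize (locally_2d_1d_const_y _ _ _ (open2_locally B u v HB Huv)).
      apply filter_imp; intros w Hw; exact (EQ w v Hw).
- intros u v Huv.
  replace (Q u v) with (0 + Q u v) by ring.
  apply derivable_pt_lim_plus; [apply derivable_pt_lim_const|]; apply is_derive_Reals.
  apply (is_derive_RInt (fun t => Q u t) (fun w => RInt (fun t => Q u t) b w) b v).
  + generalize (locally_2d_1d_const_x _ _ _ (open2_locally B u v HB Huv)).
    apply filter_imp; intros w Hw; apply (RInt_correct (fun t => Q u t)), (EQ u w Hw).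
  + apply continuity_2d_slice_v, cont2_pointwise with B; auto.
Qed.

(** * The inverse function theorem in the plane *)

Lemma geometric_cauchy (w : nat -> R) rho : 0 <= rho ->
  (forall n, Rabs (w (S n) - w n) <= rho * (/ 2) ^ n) ->
  exists l, forall n, Rabs (l - w n) <= 2 * rho * (/ 2) ^ n.
Proof.
intros Hrho Hw.
(* The factor [1 - (/ 2) ^ m] is that of the partial geometric sum; carrying it exactly is what lets
   the induction close. *)
assert (Hm : forall n m, Rabs (w (n + m)%nat - w n) <= 2 * rho * (/ 2) ^ n * (1 - (/ 2) ^ m)).
{ intros n m; induction m as [|m IH].
  - rewrite Nat.add_0_r; unfold Rminus at 1; rewrite Rplus_opp_r, Rabs_R0; simpl; lra.
  - rewrite Nat.add_succ_r; specialize (Hw (n + m)%nat); rewrite pow_add in Hw.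
    replace (w (S (n + m)) - w n) with
      ((w (S (n + m)) - w (n + m)%nat) + (w (n + m)%nat - w n)) by ring.
    eapply Rle_trans; [apply Rabs_triang|]; simpl; lra. }
assert (Hle : forall n m, Rabs (w (n + m)%nat - w n) <= 2 * rho * (/ 2) ^ n).
{ intros n m; eapply Rle_trans; [apply Hm|].
  assert (0 < (/ 2) ^ m) by (apply pow_lt; lra).
  assert (0 < (/ 2) ^ n) by (apply pow_lt; lra).
  assert (0 <= rho * (/ 2) ^ n) by (apply Rmult_le_pos; lra). nra. }
assert (Hex : ex_finite_lim_seq w).
{ apply ex_lim_seq_cauchy_corr; intros eps.
  assert (Hlim : is_lim_seq (fun n => 4 * rho * (/ 2) ^ n) 0).
  { replace (Finite 0) with (Rbar_mult (4 * rho) 0) by (simpl; f_equal; ring).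
    apply is_lim_seq_scal_l, is_lim_seq_geom; rewrite Rabs_pos_eq; lra. }
  apply is_lim_seq_spec in Hlim; destruct (Hlim eps) as [N HN]; exists N.
  intros n m Hn Hm'.
  specialize (HN N (le_n N)); rewrite Rminus_0_r in HN; apply Rabs_def2 in HN.
  pose proof (Hle N (n - N)%nat) as H1; pose proof (Hle N (m - N)%nat) as H2.
  replace (N + (n - N))%nat with n in H1 by lia.
  replace (N + (m - N))%nat with m in H2 by lia.
  replace (w n - w m) with ((w n - w N) - (w m - w N)) by ring.
  eapply Rle_lt_trans; [apply Rabs_triang|]; rewrite Rabs_Ropp; lra. }
destruct Hex as [l Hl]; exists l; intros n.
apply (is_lim_seq_le (fun m => Rabs (w (n + m)%nat - w n)) (fun _ => 2 * rho * (/ 2) ^ n)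
  (Finite (Rabs (l - w n))) (Finite (2 * rho * (/ 2) ^ n))).
- exact (Hle n).
- apply is_lim_seq_abs with (l := Finite (l - w n)).
  apply is_lim_seq_minus'; [|apply is_lim_seq_const].
  apply is_lim_seq_ext with (fun m => w (m + n)%nat); [intros; f_equal; lia|].
  now apply is_lim_seq_incr_n.
- apply is_lim_seq_const.
Qed.

Lemma le_geometric_eq0 x C : (forall n, Rabs x <= C * (/ 2) ^ n) -> x = 0.
Proof.
intros H; destruct (Req_dec x 0) as [|Hx]; [assumption|exfalso].
apply Rabs_pos_lt in Hx.
assert (Hlim : is_lim_seq (fun n => C * (/ 2) ^ n) 0).
{ replace (Finite 0) with (Rbar_mult C 0) by (simpl; f_equal; ring).
  apply is_lim_seq_scal_l, is_lim_seq_geom; rewrite Rabs_pos_eq; lra. }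
assert (Hle : Rbar_le (Rabs x) 0).
{ apply (is_lim_seq_le (fun _ => Rabs x) (fun n => C * (/ 2) ^ n)); auto.
  apply is_lim_seq_const. }
simpl in Hle; lra.
Qed.

(** Banach iteration from the centre. The steps halve, so the iterates and their limit stay within
    [2 * rho < r] of the centre; the strict bound on the initial displacement keeps the limit inside
    the open box. *)
Lemma box_fixed_point a b r (g1 g2 : R -> R -> R) :
  (forall u v u' v', box a b r u v -> box a b r u' v' ->
    Rabs (g1 u' v' - g1 u v) + Rabs (g2 u' v' - g2 u v)
      <= / 2 * (Rabs (u' - u) + Rabs (v' - v))) ->
  Rabs (g1 a b - a) + Rabs (g2 a b - b) < r / 2 ->
  exists u v, box a b r u v /\ g1 u v = u /\ g2 u v = v.
Proof.
intros Hg Hstart.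
set (rho := Rabs (g1 a b - a) + Rabs (g2 a b - b)) in *.
assert (Hrho : 0 <= rho) by (apply Rplus_le_le_0_compat; apply Rabs_pos).
pose (w := nat_rect (fun _ => (R * R)%type) (a, b)
  (fun _ p => (g1 (fst p) (snd p), g2 (fst p) (snd p)))).
pose (d n := Rabs (fst (w (S n)) - fst (w n)) + Rabs (snd (w (S n)) - snd (w n))).
(* The two bounds are proved together: the contraction estimate applies only inside the box, and
   staying inside the box relies on the decay of earlier steps. *)
assert (Hin : forall n, Rabs (fst (w n) - a) + Rabs (snd (w n) - b) <= 2 * rho * (1 - (/ 2) ^ n)
                        /\ d n <= rho * (/ 2) ^ n).
{ assert (HB : forall n, Rabs (fst (w n) - a) + Rabs (snd (w n) - b) <= 2 * rho * (1 - (/ 2) ^ n)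
       -> box a b r (fst (w n)) (snd (w n))).
  { intros n H; assert (0 < (/ 2) ^ n) by (apply pow_lt; lra).
    assert (0 <= rho * (/ 2) ^ n) by (apply Rmult_le_pos; lra).
    pose proof (Rabs_pos (fst (w n) - a)); pose proof (Rabs_pos (snd (w n) - b)).
    split; lra. }
  induction n as [|n [IH1 IH2]].
  - simpl; unfold d; simpl; unfold Rminus; rewrite !Rplus_opp_r, Rabs_R0.
    split; [lra|]; unfold rho, Rminus; lra.
  - assert (Hnext : Rabs (fst (w (S n)) - a) + Rabs (snd (w (S n)) - b)
                      <= 2 * rho * (1 - (/ 2) ^ S n)).
    { replace (fst (w (S n)) - a) with ((fst (w (S n)) - fst (w n)) + (fst (w n) - a)) by ring.
      replace (snd (w (S n)) - b) with ((snd (w (S n)) - snd (w n)) + (snd (w n) - b)) by ring.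
      pose proof (Rabs_triang (fst (w (S n)) - fst (w n)) (fst (w n) - a)).
      pose proof (Rabs_triang (snd (w (S n)) - snd (w n)) (snd (w n) - b)).
      unfold d in IH2; change ((/ 2) ^ S n) with (/ 2 * (/ 2) ^ n); lra. }
    split; [exact Hnext|].
    pose proof (Hg _ _ _ _ (HB n IH1) (HB (S n) Hnext)) as HL.
    change (d (S n) <= / 2 * d n) in HL; change ((/ 2) ^ S n) with (/ 2 * (/ 2) ^ n); lra. }
destruct (geometric_cauchy (fun n => fst (w n)) rho Hrho) as [l1 Hl1].
{ intros n; pose proof (proj2 (Hin n)) as H; unfold d in H.
  pose proof (Rabs_pos (snd (w (S n)) - snd (w n))); lra. }
destruct (geometric_cauchy (fun n => snd (w n)) rho Hrho) as [l2 Hl2].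
{ intros n; pose proof (proj2 (Hin n)) as H; unfold d in H.
  pose proof (Rabs_pos (fst (w (S n)) - fst (w n))); lra. }
assert (HBl : box a b r l1 l2).
{ pose proof (Hl1 0%nat) as H1; pose proof (Hl2 0%nat) as H2; simpl in H1, H2; split; lra. }
assert (HBn : forall n, box a b r (fst (w n)) (snd (w n))).
{ intros n; destruct (Hin n) as [H _].
  assert (0 < (/ 2) ^ n) by (apply pow_lt; lra).
  assert (0 <= rho * (/ 2) ^ n) by (apply Rmult_le_pos; lra).
  pose proof (Rabs_pos (fst (w n) - a)); pose proof (Rabs_pos (snd (w n) - b)).
  split; lra. }
(* The iterate [w (S n)] is inserted between the limit and its image. The two resulting sums are
   each at most [2 * rho * (/ 2) ^ n], so the constant [8] is generous. *)
assert (Hfix : forall n, Rabs (g1 l1 l2 - l1) + Rabs (g2 l1 l2 - l2) <= 8 * rho * (/ 2) ^ n).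
{ intros n; pose proof (Hg _ _ _ _ (HBn n) HBl) as HL.
  change (Rabs (g1 l1 l2 - fst (w (S n))) + Rabs (g2 l1 l2 - snd (w (S n)))
     <= / 2 * (Rabs (l1 - fst (w n)) + Rabs (l2 - snd (w n)))) in HL.
  pose proof (Hl1 n); pose proof (Hl2 n).
  pose proof (Hl1 (S n)) as H1; pose proof (Hl2 (S n)) as H2.
  change ((/ 2) ^ S n) with (/ 2 * (/ 2) ^ n) in H1, H2.
  rewrite Rabs_minus_sym in H1, H2.
  pose proof (Rabs_triang (g1 l1 l2 - fst (w (S n))) (fst (w (S n)) - l1)) as T1.
  pose proof (Rabs_triang (g2 l1 l2 - snd (w (S n))) (snd (w (S n)) - l2)) as T2.
  replace (g1 l1 l2 - fst (w (S n)) + (fst (w (S n)) - l1)) with (g1 l1 l2 - l1) in T1 by ring.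
  replace (g2 l1 l2 - snd (w (S n)) + (snd (w (S n)) - l2)) with (g2 l1 l2 - l2) in T2 by ring.
  assert (0 < (/ 2) ^ n) by (apply pow_lt; lra).
  assert (0 <= rho * (/ 2) ^ n) by (apply Rmult_le_pos; lra). lra. }
exists l1, l2; split; [exact HBl|].
split; apply Rminus_diag_uniq, le_geometric_eq0 with (8 * rho); intros n;
  pose proof (Hfix n); pose proof (Rabs_pos (g1 l1 l2 - l1));
  pose proof (Rabs_pos (g2 l1 l2 - l2)); lra.
Qed.

(** Write F = (S, T) and let A be the inverse of its Jacobian at [(u0, v0)]. The map N(w) = w - A
    F(w) has vanishing derivative at that point, hence is a half-contraction on a small square [Q],
    and F(w) = p is the fixed-point equation w = A p + N(w). The neighbourhood [W] of the image
    point is chosen small enough for solvability, so F may send parts of [Q] outside [W]; this is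
    why the left-inverse clause asks for [W (S u v) (T u v)]. *)
Lemma local_inverse (U : Dom) S T Su Sv Tu Tv u0 v0 : open2 U -> U u0 v0 ->
  pdu U S Su -> pdv U S Sv -> pdu U T Tu -> pdv U T Tv ->
  cont2 U Su -> cont2 U Sv -> cont2 U Tu -> cont2 U Tv ->
  (forall u v, U u v -> Su u v * Tv u v - Sv u v * Tu u v <> 0) ->
  exists (Q W : Dom) (p1 p2 : R -> R -> R),
    open2 Q /\ open2 W /\ Q u0 v0 /\ (forall u v, Q u v -> U u v) /\ W (S u0 v0) (T u0 v0) /\
    (forall s t, W s t ->
       Q (p1 s t) (p2 s t) /\ S (p1 s t) (p2 s t) = s /\ T (p1 s t) (p2 s t) = t) /\
    (forall u v, Q u v -> W (S u v) (T u v) -> p1 (S u v) (T u v) = u /\ p2 (S u v) (T u v) = v) /\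
    cont2 W p1 /\ cont2 W p2 /\
    let D u v := Su u v * Tv u v - Sv u v * Tu u v in
    pdu W p1 (fun s t => Tv (p1 s t) (p2 s t) / D (p1 s t) (p2 s t)) /\
    pdv W p1 (fun s t => - Sv (p1 s t) (p2 s t) / D (p1 s t) (p2 s t)) /\
    pdu W p2 (fun s t => - Tu (p1 s t) (p2 s t) / D (p1 s t) (p2 s t)) /\
    pdv W p2 (fun s t => Su (p1 s t) (p2 s t) / D (p1 s t) (p2 s t)).
Proof.
intros HU H0 DSu DSv DTu DTv CSu CSv CTu CTv HD.
set (D u v := Su u v * Tv u v - Sv u v * Tu u v).
assert (HD0 : D u0 v0 <> 0) by (apply HD, H0).
(* The rows of A are [(al, be)] and [(ga, de)]; [N1] and [N2] are the components of N. *)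
pose (al := Tv u0 v0 / D u0 v0); pose (be := - Sv u0 v0 / D u0 v0).
pose (ga := - Tu u0 v0 / D u0 v0); pose (de := Su u0 v0 / D u0 v0).
pose (N1 u v := (1 * u + 0 * v) + (- al * S u v + - be * T u v)).
pose (N2 u v := (0 * u + 1 * v) + (- ga * S u v + - de * T u v)).
pose (N1u u v := 1 + (- al * Su u v + - be * Tu u v)).
pose (N1v u v := 0 + (- al * Sv u v + - be * Tv u v)).
pose (N2u u v := 0 + (- ga * Su u v + - de * Tu u v)).
pose (N2v u v := 1 + (- ga * Sv u v + - de * Tv u v)).
assert (Dlin : forall (k l : R),
   pdu U (fun u v => k * S u v + l * T u v) (fun u v => k * Su u v + l * Tu u v)
   /\ pdv U (fun u v => k * S u v + l * T u v) (fun u v => k * Sv u v + l * Tv u v)).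
{ intros k l; split; intros u v Huv; apply derivable_pt_lim_plus;
    apply derivable_pt_lim_scal; auto. }
(* With all four partials of N bounded by [/ 4], each component is [/ 4]-Lipschitz for the sum norm,
   and the two together give the contraction factor [/ 2]. *)
assert (small : forall f, cont2 U f -> f u0 v0 = 0 ->
  exists r, 0 < r /\ forall u v, box u0 v0 r u v -> U u v /\ Rabs (f u v) <= / 4).
{ intros f Cf Hf; destruct (Cf u0 v0 H0 (/ 4)) as [d [Hd Hfd]]; [lra|].
  destruct (open2_box_inside U u0 v0 HU H0) as [e [He Hin]].
  exists (Rmin d e); split; [now apply Rmin_pos|]; intros u v [Hu Hv].
  pose proof (Rmin_l d e); pose proof (Rmin_r d e).
  assert (Huv : U u v) by (apply Hin; split; lra).
  split; [exact Huv|]; rewrite <- (Rminus_0_r (f u v)), <- Hf; apply Rlt_le, Hfd; auto; lra. }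
assert (Clin : forall c (k l : R) f g, cont2 U f -> cont2 U g ->
  cont2 U (fun u v => c + (k * f u v + l * g u v))).
{ intros c k l f g Cf Cg.
  apply (Ck_plus U HU 0); [apply (Ck_const 0)|].
  apply (Ck_plus U HU 0); apply (Ck_mult U HU 0); auto; apply (Ck_const 0). }
destruct (small N1u (Clin _ _ _ _ _ CSu CTu)) as [r1 [Hr1 B1]].
{ unfold N1u, al, be, D in *; field; exact HD0. }
destruct (small N1v (Clin _ _ _ _ _ CSv CTv)) as [r2 [Hr2 B2]].
{ unfold N1v, al, be, D in *; field; exact HD0. }
destruct (small N2u (Clin _ _ _ _ _ CSu CTu)) as [r3 [Hr3 B3]].
{ unfold N2u, ga, de, D in *; field; exact HD0. }
destruct (small N2v (Clin _ _ _ _ _ CSv CTv)) as [r4 [Hr4 B4]].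
{ unfold N2v, ga, de, D in *; field; exact HD0. }
set (r := Rmin (Rmin r1 r2) (Rmin r3 r4)).
assert (Hr : 0 < r) by (repeat apply Rmin_pos; assumption).
set (Q := box u0 v0 r).
assert (HQ : forall r', r <= r' -> forall u v, Q u v -> box u0 v0 r' u v)
  by (intros r' Hr' u v [Hu Hv]; split; lra).
pose proof (Rmin_l (Rmin r1 r2) (Rmin r3 r4)); pose proof (Rmin_r (Rmin r1 r2) (Rmin r3 r4)).
pose proof (Rmin_l r1 r2); pose proof (Rmin_r r1 r2).
pose proof (Rmin_l r3 r4); pose proof (Rmin_r r3 r4).
fold r in H, H1.
assert (QU : forall u v, Q u v -> U u v) by (intros u v q; apply (B1 u v), HQ; [lra|exact q]).
assert (LN : forall u v u' v', Q u v -> Q u' v' ->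
  Rabs (N1 u' v' - N1 u v) + Rabs (N2 u' v' - N2 u v) <= / 2 * (Rabs (u' - u) + Rabs (v' - v))).
{ intros u v u' v' q q'.
  assert (L1 : Rabs (N1 u' v' - N1 u v) <= / 4 * (Rabs (u' - u) + Rabs (v' - v))).
  { apply (box_lipschitz N1 N1u N1v u0 v0 r); auto.
    - apply pdu_restrict with U; auto; apply pdu_plus; [apply pdu_linear|apply Dlin].
    - apply pdv_restrict with U; auto; apply pdv_plus; [apply pdv_linear|apply Dlin].
    - intros s t q1; split; [apply B1|apply B2]; apply HQ; auto; lra. }
  assert (L2 : Rabs (N2 u' v' - N2 u v) <= / 4 * (Rabs (u' - u) + Rabs (v' - v))).
  { apply (box_lipschitz N2 N2u N2v u0 v0 r); auto.
    - apply pdu_restrict with U; auto; apply pdu_plus; [apply pdu_linear|apply Dlin].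
    - apply pdv_restrict with U; auto; apply pdv_plus; [apply pdv_linear|apply Dlin].
    - intros s t q1; split; [apply B3|apply B4]; apply HQ; auto; lra. }
  lra. }
(* [M] bounds A from the sup norm to the sum norm; the added 1 makes it positive even before A is
   known to be nonzero. *)
set (M := Rabs al + Rabs be + Rabs ga + Rabs de + 1).
assert (HM : 0 < M).
{ unfold M; pose proof (Rabs_pos al); pose proof (Rabs_pos be);
  pose proof (Rabs_pos ga); pose proof (Rabs_pos de); lra. }
assert (HMb : forall x y e, Rabs x <= e -> Rabs y <= e ->
  Rabs (al * x + be * y) + Rabs (ga * x + de * y) <= M * e).
{ intros x y e Hx Hy.
  assert (K : forall k z, Rabs z <= e -> Rabs (k * z) <= Rabs k * e).
  { intros k z Hz; rewrite Rabs_mult; apply Rmult_le_compat_l; [apply Rabs_pos|exact Hz]. }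
  pose proof (Rabs_triang (al * x) (be * y)); pose proof (Rabs_triang (ga * x) (de * y)).
  pose proof (K al x Hx); pose proof (K be y Hy); pose proof (K ga x Hx); pose proof (K de y Hy).
  assert (0 <= e) by (pose proof (Rabs_pos x); lra). unfold M; lra. }
(* Since [w = N w + A (F w)] with [N] a half-contraction, [F] expands distances by a
   definite factor; this gives injectivity and a Lipschitz inverse. *)
assert (Hexp : forall u v u' v' e, Q u v -> Q u' v' ->
  Rabs (S u' v' - S u v) <= e -> Rabs (T u' v' - T u v) <= e ->
  Rabs (u' - u) + Rabs (v' - v) <= 2 * M * e).
{ intros u v u' v' e q q' HS HT.
  pose proof (HMb _ _ _ HS HT) as K; pose proof (LN _ _ _ _ q q') as L.
  pose proof (Rabs_triang (N1 u' v' - N1 u v)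
    (al * (S u' v' - S u v) + be * (T u' v' - T u v))) as T1.
  pose proof (Rabs_triang (N2 u' v' - N2 u v)
    (ga * (S u' v' - S u v) + de * (T u' v' - T u v))) as T2.
  replace (N1 u' v' - N1 u v + (al * (S u' v' - S u v) + be * (T u' v' - T u v)))
    with (u' - u) in T1 by (unfold N1; ring).
  replace (N2 u' v' - N2 u v + (ga * (S u' v' - S u v) + de * (T u' v' - T u v)))
    with (v' - v) in T2 by (unfold N2; ring).
  lra. }
assert (Hinj : forall u v u' v', Q u v -> Q u' v' -> S u' v' = S u v -> T u' v' = T u v ->
  u' = u /\ v' = v).
{ intros u v u' v' q q' HS HT.
  assert (E : Rabs (u' - u) + Rabs (v' - v) <= 2 * M * 0).
  { apply Hexp; auto; [rewrite HS|rewrite HT]; unfold Rminus; rewrite Rplus_opp_r, Rabs_R0; lra. }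
  pose proof (Rabs_pos (u' - u)); pose proof (Rabs_pos (v' - v)).
  split; apply Rminus_diag_uniq; apply Rabs_eq_0; lra. }
(* With this radius A moves the centre by at most [r / 4], below the [r / 2] that the fixed-point
   lemma allows. *)
set (W := box (S u0 v0) (T u0 v0) (r / (4 * M))).
assert (HrM : 0 < r / (4 * M)) by (apply Rdiv_lt_0_compat; lra).
(* The implication stands under the existential, with the default [(0, 0)] off [W], so that choice
   over all pairs yields total functions [p1] and [p2]. *)
assert (Hsurj : forall p : R * R, exists w : R * R, W (fst p) (snd p) ->
  Q (fst w) (snd w) /\ S (fst w) (snd w) = fst p /\ T (fst w) (snd w) = snd p).
{ intros [s t]; simpl; destruct (classic (W s t)) as [HWst|]; [|exists (0, 0); tauto].
  destruct (box_fixed_point u0 v0 r (fun u v => al * s + be * t + N1 u v)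
     (fun u v => ga * s + de * t + N2 u v)) as [u [v [q [E1 E2]]]].
  - intros u v u' v' q q'; eapply Rle_trans; [|apply (LN u v u' v' q q')].
    apply Req_le; f_equal; f_equal; ring.
  - destruct HWst as [Hs Ht].
    pose proof (HMb (s - S u0 v0) (t - T u0 v0) (r / (4 * M)) (Rlt_le _ _ Hs) (Rlt_le _ _ Ht)) as K.
    replace (M * (r / (4 * M))) with (r / 4) in K by (field; lra).
    replace (al * s + be * t + N1 u0 v0 - u0) with (al * (s - S u0 v0) + be * (t - T u0 v0))
      by (unfold N1; ring).
    replace (ga * s + de * t + N2 u0 v0 - v0) with (ga * (s - S u0 v0) + de * (t - T u0 v0))
      by (unfold N2; ring).
    lra.
  - exists (u, v); simpl; intros _; split; [exact q|].
    assert (F1 : al * (s - S u v) + be * (t - T u v) = 0) by (unfold N1 in E1; lra).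
    assert (F2 : ga * (s - S u v) + de * (t - T u v) = 0) by (unfold N2 in E2; lra).
    (* The fixed point gives A (p - F(w)) = 0; multiplying by the Jacobian at [(u0, v0)] cancels
       A. *)
    split; apply Rminus_diag_uniq_sym.
    + replace (s - S u v) with (Su u0 v0 * (al * (s - S u v) + be * (t - T u v))
        + Sv u0 v0 * (ga * (s - S u v) + de * (t - T u v)))
        by (unfold al, be, ga, de, D in *; field; exact HD0).
      rewrite F1, F2; ring.
    + replace (t - T u v) with (Tu u0 v0 * (al * (s - S u v) + be * (t - T u v))
        + Tv u0 v0 * (ga * (s - S u v) + de * (t - T u v)))
        by (unfold al, be, ga, de, D in *; field; exact HD0).
      rewrite F1, F2; ring. }
pose (sel p := proj1_sig (constructive_indefinite_description _ (Hsurj p))).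
pose (p1 s t := fst (sel (s, t))); pose (p2 s t := snd (sel (s, t))).
assert (Hp : forall s t, W s t ->
  Q (p1 s t) (p2 s t) /\ S (p1 s t) (p2 s t) = s /\ T (p1 s t) (p2 s t) = t).
{ intros s t; exact (proj2_sig (constructive_indefinite_description _ (Hsurj (s, t)))). }
assert (Hlip : forall s t s' t', W s t -> W s' t' ->
  Rabs (p1 s' t' - p1 s t) + Rabs (p2 s' t' - p2 s t)
    <= 2 * M * Rmax (Rabs (s' - s)) (Rabs (t' - t))).
{ intros s t s' t' w w'; destruct (Hp s t w) as [q [Es Et]].
  destruct (Hp s' t' w') as [q' [Es' Et']].
  apply Hexp; auto; rewrite ?Es, ?Es', ?Et, ?Et'; [apply Rmax_l|apply Rmax_r]. }
assert (HC : cont2 W p1 /\ cont2 W p2).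
{ cut (forall s t, W s t -> forall eps, 0 < eps -> exists d, 0 < d /\ forall s' t', W s' t' ->
    Rabs (s' - s) < d -> Rabs (t' - t) < d ->
    Rabs (p1 s' t' - p1 s t) + Rabs (p2 s' t' - p2 s t) < eps).
  { intros K; split; intros s t w eps Heps; destruct (K s t w eps Heps) as [d [Hd Kd]];
    exists d; split; auto; intros s' t' w' Hs Ht; pose proof (Kd s' t' w' Hs Ht);
    pose proof (Rabs_pos (p1 s' t' - p1 s t)); pose proof (Rabs_pos (p2 s' t' - p2 s t)); lra. }
  intros s t w eps Heps; exists (eps / (2 * M)); split; [apply Rdiv_lt_0_compat; lra|].
  intros s' t' w' Hs Ht; eapply Rle_lt_trans; [apply (Hlip s t s' t' w w')|].
  replace eps with (2 * M * (eps / (2 * M))) at 1 by (field; lra).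
  apply Rmult_lt_compat_l; [lra|]; now apply Rmax_lub_lt. }
assert (HW : open2 W) by apply open2_box.
(* With [e1], [e2] the first-order remainders of [S] and [T], an inverse row [(lx, ly)] of the
   Jacobian satisfies [dp - (lx ds + ly dt) = - (lx e1 + ly e2)]. *)
assert (Hdiff : forall lx ly (k l : R) (p : R -> R -> R) s t, W s t ->
  lx * Su (p1 s t) (p2 s t) + ly * Tu (p1 s t) (p2 s t) = k ->
  lx * Sv (p1 s t) (p2 s t) + ly * Tv (p1 s t) (p2 s t) = l ->
  (forall s' t', p s' t' - p s t = k * (p1 s' t' - p1 s t) + l * (p2 s' t' - p2 s t)) ->
  differentiable_pt_lim p s t lx ly).
{ intros lx ly k l p s t w Hk Hl Hpp eps.
  destruct (Hp s t w) as [q [Es Et]].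
  set (L := Rabs lx + Rabs ly + 1).
  assert (HL : 0 < L) by (unfold L; pose proof (Rabs_pos lx); pose proof (Rabs_pos ly); lra).
  (* [2 * M] is the Lipschitz constant of the inverse and [L] bounds the row [(lx, ly)]; both
     factors reappear in the final estimate and cancel here. *)
  assert (He : 0 < eps / (2 * M * L)).
  { apply Rdiv_lt_0_compat; [apply cond_pos|]; apply Rmult_lt_0_compat; lra. }
  destruct (differentiable_of_partials U S Su Sv HU DSu DSv CSu CSv _ _ (QU _ _ q)
    (mkposreal _ He)) as [d1 Hd1].
  destruct (differentiable_of_partials U T Tu Tv HU DTu DTv CTu CTv _ _ (QU _ _ q)
    (mkposreal _ He)) as [d2 Hd2].
  simpl in Hd1, Hd2.
  assert (Hd : 0 < Rmin d1 d2 / (2 * M)).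
  { apply Rdiv_lt_0_compat; [apply Rmin_pos; apply cond_pos|lra]. }
  destruct (open2_box_inside W s t HW w) as [d3 [Hd3 Hin]].
  exists (mkposreal _ (Rmin_pos _ _ Hd Hd3)); simpl; intros s' t' Hs Ht.
  pose proof (Rmin_l (Rmin d1 d2 / (2 * M)) d3); pose proof (Rmin_r (Rmin d1 d2 / (2 * M)) d3).
  assert (w' : W s' t') by (apply Hin; split; lra).
  destruct (Hp s' t' w') as [q' [Es' Et']].
  set (m := Rmax (Rabs (s' - s)) (Rabs (t' - t))).
  assert (Hm : 0 <= m) by (eapply Rle_trans; [apply Rabs_pos|apply Rmax_l]).
  pose proof (Hlip s t s' t' w w') as HLp; fold m in HLp.
  assert (Hmd : 2 * M * m < Rmin d1 d2).
  { replace (Rmin d1 d2) with (2 * M * (Rmin d1 d2 / (2 * M))) by (field; lra).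
    apply Rmult_lt_compat_l; [lra|]; apply Rmax_lub_lt; lra. }
  pose proof (Rmin_l d1 d2); pose proof (Rmin_r d1 d2).
  pose proof (Rabs_pos (p1 s' t' - p1 s t)); pose proof (Rabs_pos (p2 s' t' - p2 s t)).
  assert (Hmax : Rmax (Rabs (p1 s' t' - p1 s t)) (Rabs (p2 s' t' - p2 s t)) <= 2 * M * m)
    by (apply Rmax_lub; lra).
  specialize (Hd1 (p1 s' t') (p2 s' t')); specialize (Hd2 (p1 s' t') (p2 s' t')).
  rewrite Es, Es' in Hd1; rewrite Et, Et' in Hd2.
  set (e1 := s' - s - _) in Hd1; set (e2 := t' - t - _) in Hd2.
  assert (He12 : Rabs e1 <= eps / L * m /\ Rabs e2 <= eps / L * m).
  { replace (eps / L * m) with (eps / (2 * M * L) * (2 * M * m)) by (field; lra).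
    split; (eapply Rle_trans; [apply Hd1 || apply Hd2; lra|]);
      apply Rmult_le_compat_l; auto; lra. }
  replace (p s' t' - p s t - (lx * (s' - s) + ly * (t' - t))) with (- (lx * e1 + ly * e2)).
  2:{ rewrite Hpp, <- Hk, <- Hl; unfold e1, e2; ring. }
  rewrite Rabs_Ropp; eapply Rle_trans; [apply Rabs_triang|]; rewrite !Rabs_mult.
  replace (eps * m) with (L * (eps / L * m)) by (field; lra).
  assert (0 <= eps / L * m).
  { apply Rmult_le_pos; [|exact Hm]; apply Rlt_le, Rdiv_lt_0_compat; [apply cond_pos|lra]. }
  assert (Rabs lx * Rabs e1 <= Rabs lx * (eps / L * m))
    by (apply Rmult_le_compat_l; [apply Rabs_pos|tauto]).
  assert (Rabs ly * Rabs e2 <= Rabs ly * (eps / L * m))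
    by (apply Rmult_le_compat_l; [apply Rabs_pos|tauto]).
  unfold L at 1; lra. }
(* A row of the inverse Jacobian times the Jacobian is a row of the identity: [(k, l)] is [(1, 0)]
   for [p1] and [(0, 1)] for [p2]. *)
assert (Dp1 : forall s t, W s t -> differentiable_pt_lim p1 s t
   (Tv (p1 s t) (p2 s t) / D (p1 s t) (p2 s t)) (- Sv (p1 s t) (p2 s t) / D (p1 s t) (p2 s t))).
{ intros s t w; assert (N : D (p1 s t) (p2 s t) <> 0) by (apply HD, QU, Hp, w).
  apply Hdiff with 1 0; auto; [unfold D in *; field; exact N|unfold D in *; field; exact N|].
  intros; ring. }
assert (Dp2 : forall s t, W s t -> differentiable_pt_lim p2 s t
   (- Tu (p1 s t) (p2 s t) / D (p1 s t) (p2 s t)) (Su (p1 s t) (p2 s t) / D (p1 s t) (p2 s t))).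
{ intros s t w; assert (N : D (p1 s t) (p2 s t) <> 0) by (apply HD, QU, Hp, w).
  apply Hdiff with 0 1; auto; [unfold D in *; field; exact N|unfold D in *; field; exact N|].
  intros; ring. }
exists Q, W, p1, p2.
split; [apply open2_box|]; split; [exact HW|]; split; [now apply box_center|].
split; [exact QU|]; split; [now apply box_center|]; split; [exact Hp|].
split.
{ intros u v q w; destruct (Hp _ _ w) as [q' [Es Et]]; now apply Hinj. }
split; [apply HC|]; split; [apply HC|]; simpl.
repeat split; intros s t w.
- exact (derivable_pt_lim_along_u _ _ _ _ _ (Dp1 s t w)).
- exact (derivable_pt_lim_along_v _ _ _ _ _ (Dp1 s t w)).
- exact (derivable_pt_lim_along_u _ _ _ _ _ (Dp2 s t w)).
- exact (derivable_pt_lim_along_v _ _ _ _ _ (Dp2 s t w)).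
Qed.

(** * Structure and Codazzi equations *)

Lemma vec_eq (a b : V4) : c0 a = c0 b -> c1 a = c1 b -> c2 a = c2 b -> c3 a = c3 b -> a = b.
Proof. destruct a, b; simpl; congruence. Qed.

Lemma dot_comm a b : dot a b = dot b a.
Proof. unfold dot; ring. Qed.

Lemma dot_vadd_l a b c : dot (vadd a b) c = dot a c + dot b c.
Proof. unfold dot, vadd; simpl; ring. Qed.

Lemma dot_vscal_l k a c : dot (vscal k a) c = k * dot a c.
Proof. unfold dot, vscal; simpl; ring. Qed.

Lemma dot_vadd_r a b c : dot c (vadd a b) = dot c a + dot c b.
Proof. unfold dot, vadd; simpl; ring. Qed.

Lemma dot_vscal_r k a c : dot c (vscal k a) = k * dot c a.
Proof. unfold dot, vscal; simpl; ring. Qed.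

Lemma forall_lt_4 (P : nat -> Prop) : P 0%nat -> P 1%nat -> P 2%nat -> P 3%nat ->
  forall i, (i < 4)%nat -> P i.
Proof. intros; do 4 (destruct i as [|i]; [assumption|]); lia. Qed.

(** * Derivatives of vector fields and of their inner products *)

Section VectorFields.
Variable U : Dom.
Hypothesis HU : open2 U.

Lemma smooth_dot X Y : smoothV U X -> smoothV U Y -> smooth U (fun u v => dot (X u v) (Y u v)).
Proof.
intros HX HY; unfold dot.
repeat apply smooth_plus; auto; apply smooth_mult; auto.
- exact (HX 0%nat ltac:(lia)).
- exact (HY 0%nat ltac:(lia)).
- exact (HX 1%nat ltac:(lia)).
- exact (HY 1%nat ltac:(lia)).
- exact (HX 2%nat ltac:(lia)).
- exact (HY 2%nat ltac:(lia)).
- exact (HX 3%nat ltac:(lia)).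
- exact (HY 3%nat ltac:(lia)).
Qed.

Lemma pdu_dot X Y Xu Yu : pduV U X Xu -> pduV U Y Yu ->
  pdu U (fun u v => dot (X u v) (Y u v)) (fun u v => dot (Xu u v) (Y u v) + dot (X u v) (Yu u v)).
Proof.
intros HX HY.
pose proof (fun i Hi => pdu_mult U _ _ _ _ (HX i Hi) (HY i Hi)) as H.
pose proof (pdu_plus _ _ _ _ _ (pdu_plus _ _ _ _ _ (pdu_plus _ _ _ _ _
  (H 0%nat ltac:(lia)) (H 1%nat ltac:(lia))) (H 2%nat ltac:(lia))) (H 3%nat ltac:(lia))) as K.
revert K; apply pdu_ext; auto; intros; unfold dot, comp; ring.
Qed.

Lemma pdv_dot X Y Xv Yv : pdvV U X Xv -> pdvV U Y Yv ->
  pdv U (fun u v => dot (X u v) (Y u v)) (fun u v => dot (Xv u v) (Y u v) + dot (X u v) (Yv u v)).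
Proof.
intros HX HY.
pose proof (fun i Hi => pdv_mult U _ _ _ _ (HX i Hi) (HY i Hi)) as H.
pose proof (pdv_plus _ _ _ _ _ (pdv_plus _ _ _ _ _ (pdv_plus _ _ _ _ _
  (H 0%nat ltac:(lia)) (H 1%nat ltac:(lia))) (H 2%nat ltac:(lia))) (H 3%nat ltac:(lia))) as K.
revert K; apply pdv_ext; auto; intros; unfold dot, comp; ring.
Qed.

Lemma smoothV_pduV X Xu : smoothV U X -> pduV U X Xu -> smoothV U Xu.
Proof. intros HX Hu i Hi; apply smooth_pdu with (comp X i); auto. Qed.

Lemma smoothV_pdvV X Xv : smoothV U X -> pdvV U X Xv -> smoothV U Xv.
Proof. intros HX Hv i Hi; apply smooth_pdv with (comp X i); auto. Qed.

Lemma smoothV_ex_pduV X : smoothV U X -> exists Xu, pduV U X Xu.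
Proof.
intros HX.
destruct (smooth_ex_pdu U _ (HX 0%nat ltac:(lia))) as [f0 H0].
destruct (smooth_ex_pdu U _ (HX 1%nat ltac:(lia))) as [f1 H1].
destruct (smooth_ex_pdu U _ (HX 2%nat ltac:(lia))) as [f2 H2].
destruct (smooth_ex_pdu U _ (HX 3%nat ltac:(lia))) as [f3 H3].
exists (fun u v => mkV4 (f0 u v) (f1 u v) (f2 u v) (f3 u v)); now refine (forall_lt_4 _ _ _ _ _).
Qed.

Lemma smoothV_ex_pdvV X : smoothV U X -> exists Xv, pdvV U X Xv.
Proof.
intros HX.
destruct (smooth_ex_pdv U _ (HX 0%nat ltac:(lia))) as [f0 H0].
destruct (smooth_ex_pdv U _ (HX 1%nat ltac:(lia))) as [f1 H1].
destruct (smooth_ex_pdv U _ (HX 2%nat ltac:(lia))) as [f2 H2].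
destruct (smooth_ex_pdv U _ (HX 3%nat ltac:(lia))) as [f3 H3].
exists (fun u v => mkV4 (f0 u v) (f1 u v) (f2 u v) (f3 u v)); now refine (forall_lt_4 _ _ _ _ _).
Qed.

Lemma mixed_partialsV X Xu Xv : smoothV U X -> pduV U X Xu -> pdvV U X Xv ->
  exists Xuv Xvu, pdvV U Xu Xuv /\ pduV U Xv Xvu /\ forall u v, U u v -> Xuv u v = Xvu u v.
Proof.
intros HX Hu Hv.
pose proof (smoothV_pduV _ _ HX Hu) as Su; pose proof (smoothV_pdvV _ _ HX Hv) as Sv.
destruct (smoothV_ex_pdvV _ Su) as [Xuv Huv]; destruct (smoothV_ex_pduV _ Sv) as [Xvu Hvu].
exists Xuv, Xvu; split; [exact Huv|]; split; [exact Hvu|]; intros u v Huv'.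
assert (E : forall i, (i < 4)%nat -> comp Xuv i u v = comp Xvu i u v).
{ intros i Hi; apply (mixed_partials U HU (comp X i) (comp Xu i) (comp Xv i)); auto.
  - exact (smooth_cont U _ (smoothV_pdvV _ _ Su Huv i Hi)).
  - exact (smooth_cont U _ (smoothV_pduV _ _ Sv Hvu i Hi)). }
apply vec_eq;
  [exact (E 0%nat ltac:(lia))|exact (E 1%nat ltac:(lia))
  |exact (E 2%nat ltac:(lia))|exact (E 3%nat ltac:(lia))].
Qed.

(* [d (X . dY) = dX ^ dY], read off as the coefficient of [dv ^ du]. *)
Lemma exterior_derivative_dot X Y Xu Xv Yu Yv : smoothV U Y ->
  pduV U X Xu -> pdvV U X Xv -> pduV U Y Yu -> pdvV U Y Yv ->
  exists fv gu,
    pdv U (fun u v => dot (X u v) (Yu u v)) fv /\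
    pdu U (fun u v => dot (X u v) (Yv u v)) gu /\
    forall u v, U u v ->
      fv u v - gu u v = dot (Xv u v) (Yu u v) - dot (Xu u v) (Yv u v).
Proof.
intros HY Xu' Xv' Yu' Yv'.
destruct (mixed_partialsV Y Yu Yv HY Yu' Yv') as [Yuv [Yvu [Huv [Hvu E]]]].
exists (fun u v => dot (Xv u v) (Yu u v) + dot (X u v) (Yuv u v)),
       (fun u v => dot (Xu u v) (Yv u v) + dot (X u v) (Yvu u v)).
split; [now apply pdv_dot|]; split; [now apply pdu_dot|].
intros u v Huv'; rewrite (E u v Huv'); ring.
Qed.

End VectorFields.

(** A right inverse of a square matrix is a left inverse. The matrix with rows [(ax, bx)] and
    [(ay, by')] writes [x], [y] in terms of [zu], [zv]; orthonormality gives one product with the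
    coframe matrix, while solving the frame equations for coordinate derivatives takes the other. *)
Lemma coefficients_inverse ax bx ay by' a1 a2 b1 b2 :
  ax * a1 + bx * a2 = 1 -> ax * b1 + bx * b2 = 0 ->
  ay * a1 + by' * a2 = 0 -> ay * b1 + by' * b2 = 1 ->
  a1 * b2 - a2 * b1 <> 0 /\
  a1 * ax + b1 * ay = 1 /\ a1 * bx + b1 * by' = 0 /\
  a2 * ax + b2 * ay = 0 /\ a2 * bx + b2 * by' = 1.
Proof.
intros H1 H2 H3 H4.
assert (HJ : (ax * by' - bx * ay) * (a1 * b2 - a2 * b1) = 1).
{ replace ((ax * by' - bx * ay) * (a1 * b2 - a2 * b1)) with
    ((ax * a1 + bx * a2) * (ay * b1 + by' * b2) - (ax * b1 + bx * b2) * (ay * a1 + by' * a2))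
    by ring.
  rewrite H1, H2, H3, H4; ring. }
set (d := ax * by' - bx * ay) in *.
assert (Hd : d <> 0) by (intros E; rewrite E in HJ; lra).
assert (E1 : d * a1 = by').
{ replace (d * a1) with (by' * (ax * a1 + bx * a2) - bx * (ay * a1 + by' * a2)) by (unfold d; ring).
  rewrite H1, H3; ring. }
assert (E2 : d * a2 = - ay).
{ replace (d * a2) with (ax * (ay * a1 + by' * a2) - ay * (ax * a1 + bx * a2)) by (unfold d; ring).
  rewrite H1, H3; ring. }
assert (E3 : d * b1 = - bx).
{ replace (d * b1) with (by' * (ax * b1 + bx * b2) - bx * (ay * b1 + by' * b2)) by (unfold d; ring).
  rewrite H2, H4; ring. }
assert (E4 : d * b2 = ax).
{ replace (d * b2) with (ax * (ay * b1 + by' * b2) - ay * (ax * b1 + bx * b2)) by (unfold d; ring).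
  rewrite H2, H4; ring. }
split; [intros E; rewrite E in HJ; lra|].
repeat split; apply (Rmult_eq_reg_l d); auto; rewrite Rmult_plus_distr_l, <- !Rmult_assoc,
  ?E1, ?E2, ?E3, ?E4; unfold d; ring.
Qed.

(** With [(k, l)] equal to [(1, 0)] or [(0, 1)] the left side is a single coordinate derivative,
    expressed through the derivatives [A] along [x] and [B] along [y]. *)
Lemma solve_coordinate_derivatives ax bx ay by' a b (k l : R) Xu Xv A B :
  a * ax + b * ay = k -> a * bx + b * by' = l ->
  vadd (vscal ax Xu) (vscal bx Xv) = A -> vadd (vscal ay Xu) (vscal by' Xv) = B ->
  vadd (vscal k Xu) (vscal l Xv) = vadd (vscal a A) (vscal b B).
Proof.
intros <- <- <- <-; apply vec_eq; unfold vadd, vscal; simpl; ring.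
Qed.

Lemma unit_combination_l X Y : vadd (vscal 1 X) (vscal 0 Y) = X.
Proof. apply vec_eq; unfold vadd, vscal; simpl; ring. Qed.

Lemma unit_combination_r X Y : vadd (vscal 0 X) (vscal 1 Y) = Y.
Proof. apply vec_eq; unfold vadd, vscal; simpl; ring. Qed.

(** * The moving frame in local coordinates *)

Definition orthonormal4 (x y n1 n2 : V4) : Prop :=
  dot x x = 1 /\ dot y y = 1 /\ dot n1 n1 = 1 /\ dot n2 n2 = 1 /\
  dot x y = 0 /\ dot x n1 = 0 /\ dot x n2 = 0 /\ dot y n1 = 0 /\ dot y n2 = 0 /\ dot n1 n2 = 0.

(* The frame equations with [gamma1 = 0] in local coordinates: [(a, b)] are the components of a
   coordinate field with respect to [(x, y)], and [xd], ... are the derivatives along it. *)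
Definition frame_equations (x y n1 n2 : V4) (nu mu g2 be1 be2 a b : R)
    (zd xd yd n1d n2d : V4) : Prop :=
  zd = vadd (vscal a x) (vscal b y) /\
  xd = vadd (vscal a (vadd (vscal 0 y) (vscal nu n1)))
            (vscal b (vadd (vscal (- g2) y) (vscal mu n2))) /\
  yd = vadd (vscal a (vadd (vscal (- 0) x) (vscal mu n2)))
            (vscal b (vadd (vscal g2 x) (vscal (- nu) n1))) /\
  n1d = vadd (vscal a (vadd (vscal (- nu) x) (vscal be1 n2)))
             (vscal b (vadd (vscal nu y) (vscal be2 n2))) /\
  n2d = vadd (vscal a (vadd (vscal (- mu) y) (vscal (- be1) n1)))
             (vscal b (vadd (vscal (- mu) x) (vscal (- be2) n1))).

Ltac expand_dot E :=
  repeat first [rewrite dot_vadd_l | rewrite dot_vadd_r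
               | rewrite dot_vscal_l | rewrite dot_vscal_r];
  destruct E as [? [? [? [? [? [? [? [? [? ?]]]]]]]]];
  repeat match goal with
    | H : dot ?a ?b = _ |- context [dot ?a ?b] => rewrite H
    | H : dot ?a ?b = _ |- context [dot ?b ?a] => rewrite (dot_comm b a), H
    end.

(** These are the values of theta1, theta2 and of the normal components of dx and dy. The products
    proportional to [a] recover [mu] and [nu]; those proportional to [b] are the ones differentiated
    for the Codazzi equations. *)
Lemma frame_equations_normal x y n1 n2 nu mu g2 be1 be2 a b zd xd yd n1d n2d :
  orthonormal4 x y n1 n2 ->
  frame_equations x y n1 n2 nu mu g2 be1 be2 a b zd xd yd n1d n2d ->
  dot x zd = a /\ dot y zd = b /\
  dot n2 xd = mu * b /\ dot n1 yd = - nu * b /\ dot n2 yd = mu * a /\ dot n1 xd = nu * a.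
Proof.
intros O [-> [-> [-> _]]]; expand_dot O; repeat split; ring.
Qed.

(* First-order structure equations (first two identities) and Codazzi equations. *)
Lemma frame_equations_wedge x y n1 n2 nu mu g2 be1 be2 a1 b1 a2 b2
    zu xu yu n1u n2u zv xv yv n1v n2v :
  orthonormal4 x y n1 n2 ->
  frame_equations x y n1 n2 nu mu g2 be1 be2 a1 b1 zu xu yu n1u n2u ->
  frame_equations x y n1 n2 nu mu g2 be1 be2 a2 b2 zv xv yv n1v n2v ->
  let J := a1 * b2 - a2 * b1 in
  dot xv zu - dot xu zv = 0 /\
  dot yv zu - dot yu zv = g2 * J /\
  dot n2v xu - dot n2u xv = - (g2 * mu + be2 * nu) * J /\
  dot n1v yu - dot n1u yv = (g2 * nu + be2 * mu) * J.
Proof.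
intros O [-> [-> [-> [-> ->]]]] [-> [-> [-> [-> ->]]]] J; unfold J; expand_dot O;
  repeat split; ring.
Qed.

(** Here theta1 = a1 du + a2 dv and theta2 = b1 du + b2 dv. The equalities [a1v u v = a2u u v] and
    [hb1v u v = hb2u u v] say that theta1 and h theta2 are closed. *)
Definition canonical_coframe (U : Dom) (z x y : R -> R -> V4) (a1 a2 b1 b2 h : R -> R -> R) :=
  exists zu zv a1v a2u hb1v hb2u,
  pduV U z zu /\ pdvV U z zv /\ smoothV U zu /\ smoothV U zv /\
  smooth U a1 /\ smooth U a2 /\ smooth U b1 /\ smooth U b2 /\ smooth U h /\
  pdv U a1 a1v /\ pdu U a2 a2u /\
  pdv U (fun u v => h u v * b1 u v) hb1v /\ pdu U (fun u v => h u v * b2 u v) hb2u /\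
  forall u v, U u v ->
    a1v u v = a2u u v /\ hb1v u v = hb2u u v /\
    a1 u v * b2 u v - a2 u v * b1 u v <> 0 /\
    zu u v = vadd (vscal (a1 u v) (x u v)) (vscal (b1 u v) (y u v)) /\
    zv u v = vadd (vscal (a2 u v) (x u v)) (vscal (b2 u v) (y u v)).

(** The Codazzi equations arise by applying d to n2 . dx = mu theta2 and n1 . dy = - nu theta2.
    These pairs put theta2 next to [mu] and [nu], so that only x(mu) and x(nu) survive in the wedge
    products, and d theta2 is known from theta2 = y . dz. *)
Lemma geometric_frame_canonical_coframe U z x y n1 n2 nu mu gamma1 gamma2 beta1 beta2 :
  geometric_frame U z x y n1 n2 nu mu gamma1 gamma2 beta1 beta2 ->
  (forall u v, U u v -> gamma1 u v = 0) ->
  open2 U /\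
  (forall u v, U u v ->
    dot (x u v) (x u v) = 1 /\ dot (y u v) (y u v) = 1 /\ dot (x u v) (y u v) = 0) /\
  exists a1 a2 b1 b2 h,
    canonical_coframe U z x y a1 a2 b1 b2 h /\
    forall u v, U u v -> 0 < h u v /\ h u v * h u v = sqrt (Rabs (mu u v ^ 2 - nu u v ^ 2)).
Proof.
intros [zu [zv [[HU [Sz [Dzu [Dzv _]]]] [Sx [Sy [Sn1 [Sn2
  [xu [xv [yu [yv [n1u [n1v [n2u [n2v [Dxu [Dxv [Dyu [Dyv [Dn1u [Dn1v [Dn2u [Dn2v
  [ax [bx [ay [by' HF]]]]]]]]]]]]]]]]]]]]]]]]]]] Hg1.
(* The coframe is defined by inner products, whose smoothness is automatic; it is then shown to
   invert the coefficient matrix of [x], [y]. *)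
pose (a1 u v := dot (x u v) (zu u v)); pose (a2 u v := dot (x u v) (zv u v)).
pose (b1 u v := dot (y u v) (zu u v)); pose (b2 u v := dot (y u v) (zv u v)).
pose (J u v := a1 u v * b2 u v - a2 u v * b1 u v).
assert (FE : forall u v, U u v -> orthonormal4 (x u v) (y u v) (n1 u v) (n2 u v) /\ J u v <> 0 /\
  frame_equations (x u v) (y u v) (n1 u v) (n2 u v) (nu u v) (mu u v) (gamma2 u v)
    (beta1 u v) (beta2 u v) (a1 u v) (b1 u v) (zu u v) (xu u v) (yu u v) (n1u u v) (n2u u v) /\
  frame_equations (x u v) (y u v) (n1 u v) (n2 u v) (nu u v) (mu u v) (gamma2 u v)
    (beta1 u v) (beta2 u v) (a2 u v) (b2 u v) (zv u v) (xv u v) (yv u v) (n1v u v) (n2v u v) /\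
  mu u v > 0 /\ nu u v <> 0 /\ mu u v ^ 2 <> nu u v ^ 2).
{ intros u v Huv; specialize (HF u v Huv); cbv zeta in HF; rewrite (Hg1 u v Huv) in HF.
  destruct HF as [Ex [Ey [Oxx [Oyy [O11 [O22 [Oxy [Ox1 [Ox2 [Oy1 [Oy2 [O12 [_
    [Fxx [Fxy [Fyx [Fyy [Fx1 [Fy1 [Fx2 [Fy2 Hmn]]]]]]]]]]]]]]]]]]]]].
  destruct (coefficients_inverse (ax u v) (bx u v) (ay u v) (by' u v)
    (a1 u v) (a2 u v) (b1 u v) (b2 u v)) as [HJ [I1 [I2 [I3 I4]]]].
  - transitivity (dot (x u v) (x u v)); [rewrite Ex at 2|exact Oxx]; unfold a1, a2.
    now rewrite dot_vadd_r, !dot_vscal_r.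
  - rewrite <- Oxy, (dot_comm (x u v)), Ex; unfold b1, b2.
    now rewrite dot_vadd_r, !dot_vscal_r.
  - rewrite <- Oxy, Ey; unfold a1, a2.
    now rewrite dot_vadd_r, !dot_vscal_r.
  - transitivity (dot (y u v) (y u v)); [rewrite Ey at 2|exact Oyy]; unfold b1, b2.
    now rewrite dot_vadd_r, !dot_vscal_r.
  - split; [repeat split; assumption|]; split; [exact HJ|].
    symmetry in Ex, Ey.
    split; [|split; [|exact Hmn]]; repeat split.
    + rewrite <- (unit_combination_l (zu u v) (zv u v)).
      exact (solve_coordinate_derivatives _ _ _ _ _ _ _ _ _ _ _ _ I1 I2 Ex Ey).
    + rewrite <- (unit_combination_l (xu u v) (xv u v)).
      exact (solve_coordinate_derivatives _ _ _ _ _ _ _ _ _ _ _ _ I1 I2 Fxx Fyx).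
    + rewrite <- (unit_combination_l (yu u v) (yv u v)).
      exact (solve_coordinate_derivatives _ _ _ _ _ _ _ _ _ _ _ _ I1 I2 Fxy Fyy).
    + rewrite <- (unit_combination_l (n1u u v) (n1v u v)).
      exact (solve_coordinate_derivatives _ _ _ _ _ _ _ _ _ _ _ _ I1 I2 Fx1 Fy1).
    + rewrite <- (unit_combination_l (n2u u v) (n2v u v)).
      exact (solve_coordinate_derivatives _ _ _ _ _ _ _ _ _ _ _ _ I1 I2 Fx2 Fy2).
    + rewrite <- (unit_combination_r (zu u v) (zv u v)).
      exact (solve_coordinate_derivatives _ _ _ _ _ _ _ _ _ _ _ _ I3 I4 Ex Ey).
    + rewrite <- (unit_combination_r (xu u v) (xv u v)).
      exact (solve_coordinate_derivatives _ _ _ _ _ _ _ _ _ _ _ _ I3 I4 Fxx Fyx).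
    + rewrite <- (unit_combination_r (yu u v) (yv u v)).
      exact (solve_coordinate_derivatives _ _ _ _ _ _ _ _ _ _ _ _ I3 I4 Fxy Fyy).
    + rewrite <- (unit_combination_r (n1u u v) (n1v u v)).
      exact (solve_coordinate_derivatives _ _ _ _ _ _ _ _ _ _ _ _ I3 I4 Fx1 Fy1).
    + rewrite <- (unit_combination_r (n2u u v) (n2v u v)).
      exact (solve_coordinate_derivatives _ _ _ _ _ _ _ _ _ _ _ _ I3 I4 Fx2 Fy2). }
clear HF; split; [exact HU|]; split.
{ intros u v Huv; destruct (FE u v Huv) as [[? [? [_ [_ [? _]]]]] _]; auto. }
pose proof (smoothV_pduV U HU _ _ Sz Dzu) as Szu; pose proof (smoothV_pdvV U HU _ _ Sz Dzv) as Szv.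
pose proof (smoothV_pduV U HU _ _ Sx Dxu) as Sxu; pose proof (smoothV_pdvV U HU _ _ Sx Dxv) as Sxv.
pose proof (smoothV_pduV U HU _ _ Sy Dyu) as Syu; pose proof (smoothV_pdvV U HU _ _ Sy Dyv) as Syv.
assert (Sa1 : smooth U a1) by now apply smooth_dot.
assert (Sa2 : smooth U a2) by now apply smooth_dot.
assert (Sb1 : smooth U b1) by now apply smooth_dot.
assert (Sb2 : smooth U b2) by now apply smooth_dot.
assert (SJ : smooth U J) by (apply smooth_minus; auto; apply smooth_mult; auto).
(* Wedging n2 . dy = mu theta1 with theta2 gives [mu] times [J], and division by the nonvanishing
   [J] exhibits [mu] as smooth. The same works for [nu] with n1 . dx = nu theta1. *)
assert (Smu : smooth U mu).
{ apply smooth_ext with (fun u v => (b2 u v * dot (n2 u v) (yu u v)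
    - b1 u v * dot (n2 u v) (yv u v)) / J u v); auto.
  - intros u v Huv; destruct (FE u v Huv) as [O [HJ [Fu [Fv _]]]].
    apply frame_equations_normal in Fu; [|exact O]; apply frame_equations_normal in Fv; [|exact O].
    destruct Fu as [_ [_ [_ [_ [-> _]]]]]; destruct Fv as [_ [_ [_ [_ [-> _]]]]].
    unfold J in *; field; exact HJ.
  - apply smooth_div; auto; [|intros u v Huv; apply (FE u v Huv)].
    apply smooth_minus; auto; apply smooth_mult; auto; now apply smooth_dot. }
assert (Snu : smooth U nu).
{ apply smooth_ext with (fun u v => (b2 u v * dot (n1 u v) (xu u v)
    - b1 u v * dot (n1 u v) (xv u v)) / J u v); auto.
  - intros u v Huv; destruct (FE u v Huv) as [O [HJ [Fu [Fv _]]]].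
    apply frame_equations_normal in Fu; [|exact O]; apply frame_equations_normal in Fv; [|exact O].
    destruct Fu as [_ [_ [_ [_ [_ ->]]]]]; destruct Fv as [_ [_ [_ [_ [_ ->]]]]].
    unfold J in *; field; exact HJ.
  - apply smooth_div; auto; [|intros u v Huv; apply (FE u v Huv)].
    apply smooth_minus; auto; apply smooth_mult; auto; now apply smooth_dot. }
pose (P u v := mu u v * mu u v + - (nu u v * nu u v)).
assert (SP : smooth U P).
{ apply smooth_plus; auto; [|apply smooth_opp; auto]; apply smooth_mult; auto. }
assert (PN : forall u v, U u v -> P u v <> 0).
{ intros u v Huv E; apply (FE u v Huv); unfold P in E; simpl; lra. }
assert (PP : forall u v, U u v -> 0 < P u v * P u v).
{ intros u v Huv; apply Rlt_0_sqr, PN, Huv. }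
(* The eighth root of [P * P] is the fourth root of the absolute value of [P]; only positive smooth
   functions are placed under the roots, whatever the sign of [P]. *)
pose (h u v := sqrt (sqrt (sqrt (P u v * P u v)))).
assert (h1 : forall u v, U u v -> 0 < sqrt (P u v * P u v))
  by (intros u v Huv; apply sqrt_lt_R0, PP, Huv).
assert (h2 : forall u v, U u v -> 0 < sqrt (sqrt (P u v * P u v)))
  by (intros u v Huv; apply sqrt_lt_R0, h1, Huv).
assert (Hh : forall u v, U u v -> 0 < h u v) by (intros u v Huv; apply sqrt_lt_R0, h2, Huv).
assert (Sh : smooth U h).
{ do 3 (apply smooth_sqrt; auto); apply smooth_mult; auto. }
assert (Hh2 : forall u v, U u v -> h u v * h u v = sqrt (sqrt (P u v * P u v)))
  by (intros u v Huv; apply sqrt_sqrt, Rlt_le, h2, Huv).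
assert (Hh4 : forall u v, U u v -> (h u v * h u v) * (h u v * h u v) = sqrt (P u v * P u v))
  by (intros u v Huv; rewrite Hh2 by exact Huv; apply sqrt_sqrt, Rlt_le, h1, Huv).
assert (Hh8 : forall u v, U u v ->
  ((h u v * h u v) * (h u v * h u v)) * ((h u v * h u v) * (h u v * h u v)) = P u v * P u v)
  by (intros u v Huv; rewrite Hh4 by exact Huv; apply sqrt_sqrt, Rlt_le, PP, Huv).
destruct (smooth_ex_pdu U mu Smu) as [muu Dmuu]; destruct (smooth_ex_pdv U mu Smu) as [muv Dmuv].
destruct (smooth_ex_pdu U nu Snu) as [nuu Dnuu]; destruct (smooth_ex_pdv U nu Snu) as [nuv Dnuv].
destruct (smooth_ex_pdu U P SP) as [Pu DPu]; destruct (smooth_ex_pdv U P SP) as [Pv DPv].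
destruct (smooth_ex_pdu U h Sh) as [hu Dhu]; destruct (smooth_ex_pdv U h Sh) as [hv Dhv].
destruct (exterior_derivative_dot U HU x z xu xv zu zv Sz Dxu Dxv Dzu Dzv)
  as [a1v [a2u [Da1v [Da2u Ea]]]].
destruct (exterior_derivative_dot U HU y z yu yv zu zv Sz Dyu Dyv Dzu Dzv)
  as [b1v [b2u [Db1v [Db2u Eb]]]].
destruct (exterior_derivative_dot U HU n2 x n2u n2v xu xv Sx Dn2u Dn2v Dxu Dxv)
  as [c1v [c2u [Dc1v [Dc2u Ec]]]].
destruct (exterior_derivative_dot U HU n1 y n1u n1v yu yv Sy Dn1u Dn1v Dyu Dyv)
  as [d1v [d2u [Dd1v [Dd2u Ed]]]].
(* In coefficients of dv ^ du the left side belongs to dmu ^ theta2, so it stands for - x(mu) J. One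
   [gamma2 * mu] comes from dn2 ^ dx, the other from mu d theta2. *)
assert (Codazzi_mu : forall u v, U u v ->
  muv u v * b1 u v - muu u v * b2 u v = - (2 * gamma2 u v * mu u v + beta2 u v * nu u v) * J u v).
{ intros u v Huv.
  assert (E1 : c1v u v = muv u v * b1 u v + mu u v * b1v u v).
  { refine (pdv_unique U _ _ (fun s t => muv s t * b1 s t + mu s t * b1v s t) Dc1v _ u v Huv).
    apply pdv_ext with (4 := pdv_mult U _ _ _ _ Dmuv Db1v); auto.
    intros s t Hst; destruct (FE s t Hst) as [O [_ [F _]]].
    symmetry; apply (frame_equations_normal _ _ _ _ _ _ _ _ _ _ _ _ _ _ _ _ O F). }
  assert (E2 : c2u u v = muu u v * b2 u v + mu u v * b2u u v).
  { refine (pdu_unique U _ _ (fun s t => muu s t * b2 s t + mu s t * b2u s t) Dc2u _ u v Huv).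
    apply pdu_ext with (4 := pdu_mult U _ _ _ _ Dmuu Db2u); auto.
    intros s t Hst; destruct (FE s t Hst) as [O [_ [_ [F _]]]].
    symmetry; apply (frame_equations_normal _ _ _ _ _ _ _ _ _ _ _ _ _ _ _ _ O F). }
  destruct (FE u v Huv) as [O [_ [Fu [Fv _]]]].
  destruct (frame_equations_wedge _ _ _ _ _ _ _ _ _ _ _ _ _ _ _ _ _ _ _ _ _ _ _ O Fu Fv)
    as [_ [W2 [W3 _]]].
  pose proof (Eb u v Huv) as Eb'; pose proof (Ec u v Huv) as Ec'.
  rewrite W2 in Eb'; rewrite W3, E1, E2 in Ec'; fold (J u v) in Eb', Ec'.
  replace (muv u v * b1 u v - muu u v * b2 u v) with
    (muv u v * b1 u v + mu u v * b1v u v - (muu u v * b2 u v + mu u v * b2u u v)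
     - mu u v * (b1v u v - b2u u v)) by ring.
  rewrite Ec', Eb'; ring. }
(* The differentiated form is now n1 . dy = - nu theta2, whence the negated [d1v] and [d2u]. *)
assert (Codazzi_nu : forall u v, U u v ->
  nuv u v * b1 u v - nuu u v * b2 u v = - (2 * gamma2 u v * nu u v + beta2 u v * mu u v) * J u v).
{ intros u v Huv.
  assert (E1 : - d1v u v = nuv u v * b1 u v + nu u v * b1v u v).
  { refine (pdv_unique U (fun s t => nu s t * b1 s t) (fun s t => - d1v s t) _ _
      (pdv_mult U _ _ _ _ Dnuv Db1v) u v Huv).
    apply pdv_ext with (fun s t => 0 + -1 * dot (n1 s t) (yu s t))
      (fun s t => 0 + -1 * d1v s t); auto.
    - intros s t Hst; destruct (FE s t Hst) as [O [_ [F _]]].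
      destruct (frame_equations_normal _ _ _ _ _ _ _ _ _ _ _ _ _ _ _ _ O F)
        as [_ [_ [_ [-> _]]]]; ring.
    - intros; ring.
    - intros s t Hst; apply derivable_pt_lim_plus; [apply derivable_pt_lim_const|].
      apply derivable_pt_lim_scal, Dd1v, Hst. }
  assert (E2 : - d2u u v = nuu u v * b2 u v + nu u v * b2u u v).
  { refine (pdu_unique U (fun s t => nu s t * b2 s t) (fun s t => - d2u s t) _ _
      (pdu_mult U _ _ _ _ Dnuu Db2u) u v Huv).
    apply pdu_ext with (fun s t => 0 + -1 * dot (n1 s t) (yv s t))
      (fun s t => 0 + -1 * d2u s t); auto.
    - intros s t Hst; destruct (FE s t Hst) as [O [_ [_ [F _]]]].
      destruct (frame_equations_normal _ _ _ _ _ _ _ _ _ _ _ _ _ _ _ _ O F)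
        as [_ [_ [_ [-> _]]]]; ring.
    - intros; ring.
    - intros s t Hst; apply derivable_pt_lim_plus; [apply derivable_pt_lim_const|].
      apply derivable_pt_lim_scal, Dd2u, Hst. }
  destruct (FE u v Huv) as [O [_ [Fu [Fv _]]]].
  destruct (frame_equations_wedge _ _ _ _ _ _ _ _ _ _ _ _ _ _ _ _ _ _ _ _ _ _ _ O Fu Fv)
    as [_ [W2 [_ W4]]].
  pose proof (Eb u v Huv) as Eb'; pose proof (Ed u v Huv) as Ed'.
  rewrite W2 in Eb'; rewrite W4 in Ed'; fold (J u v) in Eb', Ed'.
  replace (nuv u v * b1 u v - nuu u v * b2 u v) with
    (nuv u v * b1 u v + nu u v * b1v u v - (nuu u v * b2 u v + nu u v * b2u u v)
     - nu u v * (b1v u v - b2u u v)) by ring.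
  rewrite <- E1, <- E2, Eb'.
  replace (- d1v u v - - d2u u v) with (- (d1v u v - d2u u v)) by ring.
  rewrite Ed'; ring. }
assert (dP : forall u v, U u v ->
  Pv u v * b1 u v - Pu u v * b2 u v = - 4 * gamma2 u v * P u v * J u v).
{ intros u v Huv.
  assert (E1 : Pv u v = 2 * mu u v * muv u v - 2 * nu u v * nuv u v).
  { rewrite (pdv_unique U P _ (fun s t => (muv s t * mu s t + mu s t * muv s t)
        - (nuv s t * nu s t + nu s t * nuv s t)) DPv) with (2 := Huv); [ring|].
    intros s t Hst; exact (derivable_pt_lim_minus _ _ _ _ _
      (pdv_mult U _ _ _ _ Dmuv Dmuv s t Hst) (pdv_mult U _ _ _ _ Dnuv Dnuv s t Hst)). }
  assert (E2 : Pu u v = 2 * mu u v * muu u v - 2 * nu u v * nuu u v).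
  { rewrite (pdu_unique U P _ (fun s t => (muu s t * mu s t + mu s t * muu s t)
        - (nuu s t * nu s t + nu s t * nuu s t)) DPu) with (2 := Huv); [ring|].
    intros s t Hst; exact (derivable_pt_lim_minus _ _ _ _ _
      (pdu_mult U _ _ _ _ Dmuu Dmuu s t Hst) (pdu_mult U _ _ _ _ Dnuu Dnuu s t Hst)). }
  rewrite E1, E2.
  replace ((2 * mu u v * muv u v - 2 * nu u v * nuv u v) * b1 u v
     - (2 * mu u v * muu u v - 2 * nu u v * nuu u v) * b2 u v)
    with (2 * mu u v * (muv u v * b1 u v - muu u v * b2 u v)
     - 2 * nu u v * (nuv u v * b1 u v - nuu u v * b2 u v)) by ring.
  rewrite Codazzi_mu, Codazzi_nu by exact Huv; unfold P; ring. }
(* Differentiating h^8 = P^2 gives 4 h^7 dh = P dP and avoids derivatives of nested roots. Wedging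
   with theta2 and replacing P^2 by h^8 leaves the common factor [4 * h u v ^ 7] to cancel. *)
assert (dh : forall u v, U u v ->
  hv u v * b1 u v - hu u v * b2 u v = - gamma2 u v * h u v * J u v).
{ intros u v Huv.
  assert (E1 : 4 * h u v ^ 7 * hv u v = P u v * Pv u v).
  { pose proof (pdv_mult U _ _ _ _ Dhv Dhv) as D2; pose proof (pdv_mult U _ _ _ _ D2 D2) as D4.
    pose proof (pdv_mult U _ _ _ _ D4 D4) as D8.
    pose proof (pdv_unique U _ _ _ (pdv_ext U _ _ _ _ HU Hh8 (fun _ _ _ => eq_refl) D8)
      (pdv_mult U _ _ _ _ DPv DPv) u v Huv) as E; simpl in E.
    cut (8 * h u v ^ 7 * hv u v = 2 * (P u v * Pv u v)); [lra|].
    etransitivity; [|etransitivity; [exact E|]]; ring. }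
  assert (E2 : 4 * h u v ^ 7 * hu u v = P u v * Pu u v).
  { pose proof (pdu_mult U _ _ _ _ Dhu Dhu) as D2; pose proof (pdu_mult U _ _ _ _ D2 D2) as D4.
    pose proof (pdu_mult U _ _ _ _ D4 D4) as D8.
    pose proof (pdu_unique U _ _ _ (pdu_ext U _ _ _ _ HU Hh8 (fun _ _ _ => eq_refl) D8)
      (pdu_mult U _ _ _ _ DPu DPu) u v Huv) as E; simpl in E.
    cut (8 * h u v ^ 7 * hu u v = 2 * (P u v * Pu u v)); [lra|].
    etransitivity; [|etransitivity; [exact E|]]; ring. }
  assert (H7 : 4 * h u v ^ 7 <> 0).
  { pose proof (pow_lt _ 7 (Hh u v Huv)); lra. }
  apply (Rmult_eq_reg_l (4 * h u v ^ 7)); [|exact H7].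
  replace (4 * h u v ^ 7 * (hv u v * b1 u v - hu u v * b2 u v)) with
    (4 * h u v ^ 7 * hv u v * b1 u v - 4 * h u v ^ 7 * hu u v * b2 u v) by ring.
  rewrite E1, E2.
  replace (P u v * Pv u v * b1 u v - P u v * Pu u v * b2 u v) with
    (P u v * (Pv u v * b1 u v - Pu u v * b2 u v)) by ring.
  rewrite dP by exact Huv.
  replace (P u v * (- 4 * gamma2 u v * P u v * J u v)) with
    (- 4 * gamma2 u v * J u v * (P u v * P u v)) by ring.
  rewrite <- Hh8 by exact Huv; ring. }
exists a1, a2, b1, b2, h; split.
- exists zu, zv, a1v, a2u, (fun u v => hv u v * b1 u v + h u v * b1v u v),
    (fun u v => hu u v * b2 u v + h u v * b2u u v).
  repeat (split; [assumption|]).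
  split; [now apply pdv_mult|]; split; [now apply pdu_mult|].
  intros u v Huv; destruct (FE u v Huv) as [O [HJ [Fu [Fv _]]]].
  destruct (frame_equations_wedge _ _ _ _ _ _ _ _ _ _ _ _ _ _ _ _ _ _ _ _ _ _ _ O Fu Fv)
    as [W1 [W2 _]]; fold (J u v) in W2.
  split; [apply Rminus_diag_uniq; rewrite Ea, W1 by exact Huv; reflexivity|].
  split; [|split; [exact HJ|split; [apply Fu|apply Fv]]].
  apply Rminus_diag_uniq.
  replace (hv u v * b1 u v + h u v * b1v u v - (hu u v * b2 u v + h u v * b2u u v)) with
    ((hv u v * b1 u v - hu u v * b2 u v) + h u v * (b1v u v - b2u u v)) by ring.
  rewrite dh, Eb, W2 by exact Huv; ring.
- intros u v Huv; split; [now apply Hh|].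
  rewrite Hh2 by exact Huv; f_equal; rewrite <- sqrt_Rsqr_abs; unfold Rsqr, P; f_equal; ring.
Qed.

(** * Canonical coordinates *)

Lemma comp_linear_combination (k l : R -> R -> R) X Y i s t : (i < 4)%nat ->
  k s t * comp X i s t + l s t * comp Y i s t
  = comp (fun s t => vadd (vscal (k s t) (X s t)) (vscal (l s t) (Y s t))) i s t.
Proof.
revert i; refine (forall_lt_4 _ _ _ _ _); reflexivity.
Qed.

Lemma pduV_comp U W p1 p2 p1s p2s z zu zv : open2 U -> open2 W ->
  (forall s t, W s t -> U (p1 s t) (p2 s t)) ->
  pduV U z zu -> pdvV U z zv -> smoothV U zu -> smoothV U zv ->
  pdu W p1 p1s -> pdu W p2 p2s ->
  pduV W (fun s t => z (p1 s t) (p2 s t)) (fun s t =>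
    vadd (vscal (p1s s t) (zu (p1 s t) (p2 s t))) (vscal (p2s s t) (zv (p1 s t) (p2 s t)))).
Proof.
intros HU HW Hp Dzu Dzv Szu Szv D1 D2 i Hi.
refine (pdu_ext W _ _ _ _ HW (fun _ _ _ => eq_refl) _
  (pdu_comp U W p1 p2 HU Hp _ _ _ _ _ (Dzu i Hi) (Dzv i Hi)
    (smooth_cont U _ (Szu i Hi)) (smooth_cont U _ (Szv i Hi)) D1 D2)).
intros s t _; simpl.
rewrite <- (comp_linear_combination _ _ (fun s t => zu (p1 s t) (p2 s t))
  (fun s t => zv (p1 s t) (p2 s t)) i s t Hi).
rewrite (Rmult_comm (p1s s t)), (Rmult_comm (p2s s t)); reflexivity.
Qed.

Lemma pdvV_comp U W p1 p2 p1t p2t z zu zv : open2 U -> open2 W ->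
  (forall s t, W s t -> U (p1 s t) (p2 s t)) ->
  pduV U z zu -> pdvV U z zv -> smoothV U zu -> smoothV U zv ->
  pdv W p1 p1t -> pdv W p2 p2t ->
  pdvV W (fun s t => z (p1 s t) (p2 s t)) (fun s t =>
    vadd (vscal (p1t s t) (zu (p1 s t) (p2 s t))) (vscal (p2t s t) (zv (p1 s t) (p2 s t)))).
Proof.
intros HU HW Hp Dzu Dzv Szu Szv D1 D2 i Hi.
refine (pdv_ext W _ _ _ _ HW (fun _ _ _ => eq_refl) _
  (pdv_comp U W p1 p2 HU Hp _ _ _ _ _ (Dzu i Hi) (Dzv i Hi)
    (smooth_cont U _ (Szu i Hi)) (smooth_cont U _ (Szv i Hi)) D1 D2)).
intros s t _; simpl.
rewrite <- (comp_linear_combination _ _ (fun s t => zu (p1 s t) (p2 s t))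
  (fun s t => zv (p1 s t) (p2 s t)) i s t Hi).
rewrite (Rmult_comm (p1t s t)), (Rmult_comm (p2t s t)); reflexivity.
Qed.

(** Potentials of the two closed forms serve as coordinates. The stated partials of [p1], [p2] form
    the inverse of the coframe matrix, so the new coordinate fields are the frame dual to the two
    forms. The same formulas, being smooth in [p1] and [p2], feed the bootstrapping. *)
Lemma closed_coframe_coordinates U f1 f2 g1 g2 f1v f2u g1v g2u u0 v0 :
  open2 U -> U u0 v0 ->
  smooth U f1 -> smooth U f2 -> smooth U g1 -> smooth U g2 ->
  pdv U f1 f1v -> pdu U f2 f2u -> pdv U g1 g1v -> pdu U g2 g2u ->
  (forall u v, U u v -> f1v u v = f2u u v /\ g1v u v = g2u u v /\
     f1 u v * g2 u v - f2 u v * g1 u v <> 0) ->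
  exists W p1 p2, reparametrization W U p1 p2 /\
    (exists s0 t0, W s0 t0 /\ p1 s0 t0 = u0 /\ p2 s0 t0 = v0) /\
    let D u v := f1 u v * g2 u v - f2 u v * g1 u v in
    pdu W p1 (fun s t => g2 (p1 s t) (p2 s t) / D (p1 s t) (p2 s t)) /\
    pdv W p1 (fun s t => - f2 (p1 s t) (p2 s t) / D (p1 s t) (p2 s t)) /\
    pdu W p2 (fun s t => - g1 (p1 s t) (p2 s t) / D (p1 s t) (p2 s t)) /\
    pdv W p2 (fun s t => f1 (p1 s t) (p2 s t) / D (p1 s t) (p2 s t)).
Proof.
intros HU H0 Sf1 Sf2 Sg1 Sg2 Df1 Df2 Dg1 Dg2 Hpt.
destruct (open2_box_inside U u0 v0 HU H0) as [r [Hr HB]].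
set (B := box u0 v0 r) in *.
assert (R0 : forall f, smooth U f -> cont2 B f)
  by (intros f Sf; apply cont2_restrict with U; [exact HB|now apply smooth_cont]).
destruct (poincare_box u0 v0 r f1 f2 f1v f2u Hr) as [S [DSu DSv]]; auto.
{ apply R0, (smooth_pdv U HU f1); auto. }
{ apply R0, (smooth_pdu U HU f2); auto. }
{ now apply pdv_restrict with U. }
{ now apply pdu_restrict with U. }
{ intros u v b; apply Hpt, HB, b. }
destruct (poincare_box u0 v0 r g1 g2 g1v g2u Hr) as [T [DTu DTv]]; auto.
{ apply R0, (smooth_pdv U HU g1); auto. }
{ apply R0, (smooth_pdu U HU g2); auto. }
{ now apply pdv_restrict with U. }
{ now apply pdu_restrict with U. }
{ intros u v b; apply Hpt, HB, b. }
destruct (local_inverse B S T f1 f2 g1 g2 u0 v0) as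
  [Q [W [p1 [p2 [HQ [HW [Q0 [QB [W0 [Hp [Hinv [C1 [C2 [D1 [D2 [D3 D4]]]]]]]]]]]]]]]]; auto.
{ apply open2_box. }
{ now apply box_center. }
{ intros u v b; apply Hpt, HB, b. }
set (D u v := f1 u v * g2 u v - f2 u v * g1 u v) in *.
assert (HpU : forall s t, W s t -> U (p1 s t) (p2 s t)) by (intros s t w; apply HB, QB, Hp, w).
assert (HD : forall u v, U u v -> D u v <> 0) by (intros u v Huv; apply Hpt, Huv).
assert (SD : smooth U D) by (apply smooth_minus; auto; apply smooth_mult; auto).
assert (Sp : smooth W p1 /\ smooth W p2).
{ apply (smooth_solution U W p1 p2 HU HW HpU (fun u v => g2 u v / D u v)
    (fun u v => - f2 u v / D u v) (fun u v => - g1 u v / D u v) (fun u v => f1 u v / D u v)); auto;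
  apply smooth_div; auto; apply smooth_opp; auto. }
exists W, p1, p2; split.
- split; [exact HW|]; split; [apply Sp|]; split; [apply Sp|]; split; [exact HpU|].
  split; [|split].
  + intros s t s' t' w w' E1 E2; destruct (Hp s t w) as [_ [Es Et]].
    destruct (Hp s' t' w') as [_ [Es' Et']]; rewrite E1, E2 in *; split; congruence.
  + (* The image of [p] is the preimage of [W] under [(S, T)]. *)
    intros u v [s [t [w [<- <-]]]]; destruct (Hp s t w) as [q [Es Et]].
    destruct (open2_box_inside Q _ _ HQ q) as [e [He HeQ]].
    assert (CS : continuity_2d_pt S (p1 s t) (p2 s t)).
    { apply differentiable_continuity_pt; exists (f1 (p1 s t) (p2 s t)), (f2 (p1 s t) (p2 s t)).
      apply differentiable_of_partials with B; auto; apply open2_box. }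
    assert (CT : continuity_2d_pt T (p1 s t) (p2 s t)).
    { apply differentiable_continuity_pt; exists (g1 (p1 s t) (p2 s t)), (g2 (p1 s t) (p2 s t)).
      apply differentiable_of_partials with B; auto; apply open2_box. }
    destruct (HW s t w) as [k [Hk HkW]].
    destruct (CS (mkposreal k Hk)) as [d1 Hd1]; destruct (CT (mkposreal k Hk)) as [d2 Hd2].
    simpl in Hd1, Hd2; rewrite Es in Hd1; rewrite Et in Hd2.
    exists (Rmin e (Rmin d1 d2)); split.
    { repeat apply Rmin_pos; auto; apply cond_pos. }
    intros u' v' Hu Hv.
    pose proof (Rmin_l e (Rmin d1 d2)); pose proof (Rmin_r e (Rmin d1 d2)).
    pose proof (Rmin_l d1 d2); pose proof (Rmin_r d1 d2).
    assert (q' : Q u' v') by (apply HeQ; split; lra).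
    assert (w' : W (S u' v') (T u' v')) by (apply HkW; [apply Hd1|apply Hd2]; lra).
    exists (S u' v'), (T u' v'); split; [exact w'|]; now apply Hinv.
  + exists (fun s t => g2 (p1 s t) (p2 s t) / D (p1 s t) (p2 s t)),
      (fun s t => - f2 (p1 s t) (p2 s t) / D (p1 s t) (p2 s t)),
      (fun s t => - g1 (p1 s t) (p2 s t) / D (p1 s t) (p2 s t)),
      (fun s t => f1 (p1 s t) (p2 s t) / D (p1 s t) (p2 s t)).
    do 4 (split; [assumption|]); intros s t w.
    pose proof (HD _ _ (HpU s t w)) as N; generalize N.
    (* The Jacobian determinant of the inverse is the reciprocal of [D]. *)
    match goal with |- _ -> ?x <> 0 => replace x with (/ D (p1 s t) (p2 s t)) end.
    * apply Rinv_neq_0_compat.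
    * unfold D in *; field; exact N.
- split; [|repeat split; assumption].
  exists (S u0 v0), (T u0 v0); split; [exact W0|]; now apply Hinv.
Qed.

Theorem theorem7p3 :
  forall (U : Dom) (z x y n1 n2 : R -> R -> V4)
         (nu mu gamma1 gamma2 beta1 beta2 : R -> R -> R),
    geometric_frame U z x y n1 n2 nu mu gamma1 gamma2 beta1 beta2 ->
    (forall u v, U u v -> gamma1 u v = 0) ->
    forall u0 v0, U u0 v0 ->
    exists (W : Dom) (p1 p2 : R -> R -> R),
      reparametrization W U p1 p2 /\
      (exists s0 t0, W s0 t0 /\ p1 s0 t0 = u0 /\ p2 s0 t0 = v0) /\
      exists ws wt : R -> R -> V4,
        pduV W (fun s t => z (p1 s t) (p2 s t)) ws /\
        pdvV W (fun s t => z (p1 s t) (p2 s t)) wt /\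
        forall s t, W s t ->
          let E := dot (ws s t) (ws s t) in
          let F := dot (ws s t) (wt s t) in
          let G := dot (wt s t) (wt s t) in
          let u := p1 s t in
          let v := p2 s t in
          E = 1 /\ F = 0 /\
          G = 1 / sqrt (Rabs (mu u v ^ 2 - nu u v ^ 2)) /\
          x u v = vscal (1 / sqrt E) (ws s t) /\
          y u v = vscal (1 / sqrt G) (wt s t).
Proof.
intros U z x y n1 n2 nu mu gamma1 gamma2 beta1 beta2 Hframe Hg1 u0 v0 H0.
destruct (geometric_frame_canonical_coframe _ _ _ _ _ _ _ _ _ _ _ _ Hframe Hg1) as
  (HU & Hxy & a1 & a2 & b1 & b2 & h & (zu & zv & a1v & a2u & hb1v & hb2u &
   Dzu & Dzv & Szu & Szv & Sa1 & Sa2 & Sb1 & Sb2 & Sh & Da1 & Da2 & Db1 & Db2 & Hpt) & Hh).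
assert (HD : forall u v, U u v ->
  a1 u v * (h u v * b2 u v) - a2 u v * (h u v * b1 u v) <> 0).
{ intros u v Huv.
  replace (a1 u v * (h u v * b2 u v) - a2 u v * (h u v * b1 u v)) with
    (h u v * (a1 u v * b2 u v - a2 u v * b1 u v)) by ring.
  apply Rmult_integral_contrapositive_currified; [|apply Hpt, Huv].
  apply Rgt_not_eq, Hh, Huv. }
destruct (closed_coframe_coordinates U a1 a2 (fun u v => h u v * b1 u v) (fun u v => h u v * b2 u v)
  a1v a2u hb1v hb2u u0 v0) as [W [p1 [p2 [Hrep [Hbase [D1 [D2 [D3 D4]]]]]]]]; auto.
{ now apply smooth_mult. }
{ now apply smooth_mult. }
{ intros u v Huv; destruct (Hpt u v Huv) as [? [? _]]; auto. }
pose proof (proj1 Hrep) as HW; pose proof (proj1 (proj2 (proj2 (proj2 Hrep)))) as HpU.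
exists W, p1, p2; split; [exact Hrep|]; split; [exact Hbase|].
do 2 eexists; split; [exact (pduV_comp U W _ _ _ _ z zu zv HU HW HpU Dzu Dzv Szu Szv D1 D3)|].
split; [exact (pdvV_comp U W _ _ _ _ z zu zv HU HW HpU Dzu Dzv Szu Szv D2 D4)|].
intros s t w; cbv beta zeta.
pose proof (HpU s t w) as Huv.
generalize (Hpt _ _ Huv) (HD _ _ Huv) (Hh _ _ Huv) (Hxy _ _ Huv); clear.
generalize (p1 s t) (p2 s t); intros u v [_ [_ [HJ [-> ->]]]] HD [Hh Hh2] [Oxx [Oyy Oxy]].
(* The frame dual to theta1 and h theta2 is [x] and [y / h]; from it [E], [F], [G] are read off,
   with [G] the inverse square of [h]. *)
match goal with |- dot ?X _ = 1 /\ dot _ ?Y = 0 /\ _ =>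
  replace X with (x u v); [replace Y with (vscal (/ h u v) (y u v))|] end.
2:{ apply vec_eq; unfold vadd, vscal; simpl; field; lra. }
2:{ apply vec_eq; unfold vadd, vscal; simpl; field; lra. }
rewrite !dot_vscal_r, !dot_vscal_l, Oxx, Oyy, Oxy, <- Hh2.
assert (Hs : sqrt (/ h u v * (/ h u v * 1)) = / h u v).
{ replace (/ h u v * (/ h u v * 1)) with (/ h u v * / h u v) by ring.
  apply sqrt_square, Rlt_le, Rinv_0_lt_compat, Hh. }
rewrite Hs, sqrt_1.
split; [reflexivity|]; split; [ring|]; split; [field; lra|].
split; apply vec_eq; unfold vscal; simpl; field; lra.
Qed.
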